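(* Consider the noisy search problem with $1/\delta=2^L$ and the hierarchical Posterior Matching strategy ($hiePM$) described in the context, run with the variable-length stopping rule. For reliability $0<\epsilon<1$, the expected search time satisfies $$\mathbb{E}[\tau_{\epsilon,\delta}] \le \frac{\log(1/\delta)}{I(1/3,\,p[2^{-l}])} + \frac{\log(1/\epsilon)}{C_1(p[\delta])} + o\Big(\log\frac{1}{\delta\epsilon}\Big),$$ for any fixed $l>0$ such that $2^{-l} > \big(e\log\frac{1}{\delta\epsilon}\big)^{-K_h}$, where $$K_h := \min\Big\{ I\big(\tfrac13,p[\tfrac12]\big),\ \tfrac23 D\big(\tfrac13 B_1+\tfrac23 B_0\,\big\|\,B_0\big)\Big\}>0,$$ with $B_1=\mathrm{Bern}(1-p[1/2])$, $B_0=\mathrm{Bern}(p[1/2])$.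
   Context: Search problem: fix $\delta\in(0,1)$ with $N=1/\delta=2^L$ for an integer $L$. A target index $\theta$ is uniformly distributed on $\{1,\dots,N\}$. A noise profile $p:(0,1)\to(0,1/2)$ is continuous and non-decreasing; write $p[x]:=p(x)$. At each time $t=1,2,\dots$ an agent chooses a query set $S_t\subseteq\{1,\dots,N\}$ as a function of past queries and observations, and observes $Y_t=\mathbb{1}(\theta\in S_t)\oplus Z_t$ ($\oplus$ = XOR), where conditionally on $S_t$, $Z_t\sim\mathrm{Bern}(p[\delta|S_t|])$, conditionally i.i.d. across time. The posterior is $\pi_i(t)=\mathbb{P}(\theta=i\mid S_1,\dots,S_t,Y_1,\dots,Y_t)$ with $\pi_i(0)=\delta$; write $\pi_S=\sum_{i\in S}\pi_i$. Variable-length stopping rule: $\tau_{\epsilon,\delta}$ is the first $t$ with $\max_i\pi_i(t)>1-\epsilon$, estimate $\hat\theta=\arg\max_i\pi_i(\tau)$. $hiePM$: let $H_l^m=\{m2^{L-l}+1,\dots,(m+1)2^{L-l}\}$ for $l=0,\dots,L$, $m=0,\dots,2^l-1$ (so $H_l^m=H_{l+1}^{2m}\cup H_{l+1}^{2m+1}$). At time $t$, let $l^*_t$ be the largest $l$ with $\max_m\pi_{H_l^m}(t)\ge\tfrac12$, and $m^*_t=\arg\max_m\pi_{H^m_{l^*_t}}(t)$. Let $(l_{t+1},m_{t+1})$ be the minimizer of $|\pi_{H^{m'}_{l'}}(t)-\tfrac12|$ over $(l',m')\in\{(l^*_t,m^*_t),(l^*_t+1,2m^*_t),(l^*_t+1,2m^*_t+1)\}$,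 and query $S_{t+1}=H^{m_{t+1}}_{l_{t+1}}$. Notation: $D(\cdot\|\cdot)$ is KL divergence; a convex combination of Bernoulli distributions denotes their mixture. $I(q,p)$ is the mutual information between input $X\sim\mathrm{Bern}(q)$ and the output of a binary symmetric channel with crossover probability $p$. $C_1(p):=D(\mathrm{Bern}(p)\|\mathrm{Bern}(1-p))$. The $o(\cdot)$ term is as $\delta\to0$ or $\epsilon\to0$. *)

(* Defs.v *)
From Stdlib Require Import Reals List Lra.
From Coquelicot Require Import Coquelicot.
Open Scope R_scope.

Fixpoint sumR (l : list R) : R :=
  match l with nil => 0 | x :: r => x + sumR r end.

Definition sum_range (a n : nat) (f : nat -> R) : R := sumR (map f (seq a n)).

(* N = 1/delta = 2^L ; the target indices {1,...,N} are encoded as 0,...,N-1 *)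
Definition Nitems (L : nat) : nat := Nat.pow 2 L.
Definition delta (L : nat) : R := / (2 ^ L).

(* A posterior is a function nat -> R (only indices < N are meaningful). *)
Definition prior (L : nat) : nat -> R := fun _ => delta L.

Definition Hsize (L l : nat) : nat := Nat.pow 2 (L - l).
Definition inH (L l m i : nat) : bool :=
  Nat.leb (m * Hsize L l) i && Nat.ltb i ((m + 1) * Hsize L l).
Definition Hmass (L : nat) (pi : nat -> R) (l m : nat) : R :=
  sum_range (m * Hsize L l) (Hsize L l) pi.

(* max_m pi_{H_l^m} (masses are nonnegative, so base 0 is harmless) *)
Definition levelmax (L : nat) (pi : nat -> R) (l : nat) : R :=
  fold_right Rmax 0 (map (Hmass L pi l) (seq 0 (Nat.pow 2 l))).

Fixpoint lstar_aux (L : nat) (pi : nat -> R) (k : nat) : nat :=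
  match k with
  | O => O
  | S k' => if Rle_dec (1/2) (levelmax L pi k) then k else lstar_aux L pi k'
  end.
Definition lstar (L : nat) (pi : nat -> R) : nat := lstar_aux L pi L.

Fixpoint argmax_aux (f : nat -> R) (l : list nat) (best : nat) : nat :=
  match l with
  | nil => best
  | m :: r => argmax_aux f r (if Rlt_dec (f best) (f m) then m else best)
  end.
Definition mstar (L : nat) (pi : nat -> R) : nat :=
  let ls := lstar L pi in
  argmax_aux (Hmass L pi ls) (seq 1 (Nat.pow 2 ls - 1)) O.

Fixpoint argmin_aux (g : nat * nat -> R) (l : list (nat * nat)) (best : nat * nat)
  : nat * nat :=
  match l with
  | nil => best
  | c :: r => argmin_aux g r (if Rlt_dec (g c) (g best) then c else best)
  end.

Definition hiePM_query (L : nat) (pi : nat -> R) : nat * nat :=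
  let ls := lstar L pi in
  let ms := mstar L pi in
  let children := if Nat.ltb ls L then (S ls, (2 * ms)%nat) :: (S ls, (2 * ms + 1)%nat) :: nil
                  else nil in
  argmin_aux (fun c => Rabs (Hmass L pi (fst c) (snd c) - 1/2)) children (ls, ms).

(* P(Y = y | theta = i, S = H_l^m) with Y = 1(theta in S) xor Z,
   Z ~ Bern(p[delta |S|]) *)
Definition chan (p : R -> R) (L : nat) (q : nat * nat) (i : nat) (y : bool) : R :=
  let r := p (INR (Hsize L (fst q)) * delta L) in
  if Bool.eqb y (inH L (fst q) (snd q) i) then 1 - r else r.

Definition update (p : R -> R) (L : nat) (pi : nat -> R) (y : bool) : nat -> R :=
  let q := hiePM_query L pi in
  let Z := sum_range 0 (Nitems L) (fun j => pi j * chan p L q j y) in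
  fun i => pi i * chan p L q i y / Z.

(* Observation histories are lists with the MOST RECENT observation first. *)
Fixpoint post (p : R -> R) (L : nat) (ys : list bool) : nat -> R :=
  match ys with
  | nil => prior L
  | y :: r => update p L (post p L r) y
  end.

Fixpoint lik (p : R -> R) (L : nat) (theta : nat) (ys : list bool) : R :=
  match ys with
  | nil => 1
  | y :: r => lik p L theta r * chan p L (hiePM_query L (post p L r)) theta y
  end.

Definition maxpost (L : nat) (pi : nat -> R) : R :=
  fold_right Rmax 0 (map pi (seq 0 (Nitems L))).

(* true iff max_i pi_i(s) <= 1 - eps for every s <= t (i.e. tau > t) *)
Fixpoint running (p : R -> R) (L : nat) (eps : R) (ys : list bool) : bool :=
  (if Rle_dec (maxpost L (post p L ys)) (1 - eps) then true else false) &&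
  match ys with nil => true | _ :: r => running p L eps r end.

Fixpoint allseqs (t : nat) : list (list bool) :=
  match t with
  | O => nil :: nil
  | S t' => flat_map (fun s => (true :: s) :: (false :: s) :: nil) (allseqs t')
  end.

Definition prob_tau_gt (p : R -> R) (L : nat) (eps : R) (t : nat) : R :=
  sumR (map (fun ys =>
      if running p L eps ys
      then sum_range 0 (Nitems L) (fun theta => delta L * lik p L theta ys)
      else 0) (allseqs t)).

(* E[tau] = sum_{t>=0} P(tau > t), in [0, +oo] *)
Definition expected_tau (p : R -> R) (L : nat) (eps : R) : Rbar :=
  Sup_seq (fun T => sum_range 0 T (prob_tau_gt p L eps)).

Definition KL_bern (a b : R) : R :=
  a * ln (a / b) + (1 - a) * ln ((1 - a) / (1 - b)).

(* I(q, r): mutual information between X ~ Bern(q) and the output of BSC(r):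
   sum_{x,y} P(x,y) ln (P(y|x) / P(y)) *)
Definition MI_bsc (q r : R) : R :=
  let py1 := q * (1 - r) + (1 - q) * r in
  q * (1 - r) * ln ((1 - r) / py1) + q * r * ln (r / (1 - py1))
  + (1 - q) * r * ln (r / py1) + (1 - q) * (1 - r) * ln ((1 - r) / (1 - py1)).

Definition C1cap (r : R) : R := KL_bern r (1 - r).

(* K_h = min{ I(1/3, p[1/2]), 2/3 D(1/3 B1 + 2/3 B0 || B0) },
   B1 = Bern(1 - p[1/2]), B0 = Bern(p[1/2]); the mixture is
   Bern(1/3 (1 - p[1/2]) + 2/3 p[1/2]) *)
Definition Kh (p : R -> R) : R :=
  Rmin (MI_bsc (1/3) (p (1/2)))
       (2/3 * KL_bern (1/3 * (1 - p (1/2)) + 2/3 * p (1/2)) (p (1/2))).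

(* Main.v *)
(* The expected number of steps is controlled by four nonnegative supermartingales of the
   posterior, one for each regime of the strategy.  Below a fixed level [k] the queried cell
   has mass in [1/3, 2/3], so the second moment of the masses of the cells of level at most
   [k] grows by a constant; this happens O(1) times on average.  At levels between [k] and
   the last one the posterior entropy, which starts at [ln (1/delta)], drops by at least
   [I(1/3, p[2^-k])] per step.  Once the queried item has mass [x >= 1/2], either [x] is
   bounded away from 1 and the sum of the squared posteriors grows by a constant, or the
   convex functional [sum_i - ln (1 - pi_i)], which is at most [ln (1/eps) + O(C1)] up to
   and including the stopping time, grows by at least [C1(p[delta]) * (2 * x - 1)].  Since
   convexity makes all four quantities monotone in mean at every step, returns to earlier
   regimes cost nothing, and the O(C1) overshoot absorbs arbitrarily small noise levels. *)
Require Import Defs.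
From Stdlib Require Import Reals List Lra Lia.
From Coquelicot Require Import Coquelicot.
Open Scope R_scope.

(** * Finite sums and maxima over lists *)

Section ListSums.
Context {A : Type}.
Implicit Types (f g : A -> R) (s : list A).

Lemma sumR_map_ext f g s :
  (forall x, In x s -> f x = g x) -> sumR (map f s) = sumR (map g s).
Proof.
  intros H; f_equal; now apply map_ext_in.
Qed.

Lemma sumR_map_le f g s :
  (forall x, In x s -> f x <= g x) -> sumR (map f s) <= sumR (map g s).
Proof.
  induction s as [|a s IH]; simpl; intros H; [lra|].
  pose proof (H a (or_introl eq_refl)).
  pose proof (IH (fun x Hx => H x (or_intror Hx))); lra.
Qed.

Lemma sumR_map_plus f g s :
  sumR (map (fun x => f x + g x) s) = sumR (map f s) + sumR (map g s).
Proof. induction s as [|a s IH]; simpl; lra. Qed.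

Lemma sumR_map_scal c f s :
  sumR (map (fun x => c * f x) s) = c * sumR (map f s).
Proof. induction s as [|a s IH]; simpl; [|rewrite IH]; lra. Qed.

Lemma sumR_map_nonneg f s :
  (forall x, In x s -> 0 <= f x) -> 0 <= sumR (map f s).
Proof.
  induction s as [|a s IH]; simpl; intros H; [lra|].
  pose proof (H a (or_introl eq_refl)).
  pose proof (IH (fun x Hx => H x (or_intror Hx))); lra.
Qed.

Lemma sumR_map_ge_term f s x :
  In x s -> (forall y, In y s -> 0 <= f y) -> f x <= sumR (map f s).
Proof.
  induction s as [|a s IH]; simpl; [easy|]; intros [->|Hx] H.
  - pose proof (sumR_map_nonneg f s (fun y Hy => H y (or_intror Hy))); lra.
  - pose proof (IH Hx (fun y Hy => H y (or_intror Hy))).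
    pose proof (H a (or_introl eq_refl)); lra.
Qed.

Lemma sumR_map_const c s : sumR (map (fun _ => c) s) = INR (length s) * c.
Proof.
  induction s as [|a s IH]; [simpl; lra|].
  change (length (a :: s)) with (S (length s)); rewrite S_INR; simpl; lra.
Qed.

Lemma le_fold_Rmax f s x : In x s -> f x <= fold_right Rmax 0 (map f s).
Proof.
  induction s as [|a s IH]; simpl; [easy|]; intros [->|Hx].
  - apply Rmax_l.
  - eapply Rle_trans; [now apply IH|apply Rmax_r].
Qed.

Lemma fold_Rmax_le f s b :
  0 <= b -> (forall x, In x s -> f x <= b) -> fold_right Rmax 0 (map f s) <= b.
Proof.
  induction s as [|a s IH]; simpl; intros Hb H; [lra|].
  apply Rmax_lub; auto.
Qed.

End ListSums.

Lemma sumR_app s1 s2 : sumR (s1 ++ s2) = sumR s1 + sumR s2.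
Proof. induction s1 as [|a s1 IH]; simpl; lra. Qed.

Lemma sum_range_split a m n f :
  sum_range a (m + n) f = sum_range a m f + sum_range (a + m) n f.
Proof.
  unfold sum_range; rewrite seq_app, map_app, sumR_app; reflexivity.
Qed.

Lemma sum_range_S n f : sum_range 0 (S n) f = sum_range 0 n f + f n.
Proof.
  rewrite <- Nat.add_1_r, sum_range_split; unfold sum_range; simpl; lra.
Qed.

(** * Logarithm inequalities, binary entropy, divergence and mutual information *)

Lemma ln_le_sub1 x : 0 < x -> ln x <= x - 1.
Proof.
  intros Hx; pose proof (exp_ineq1_le (ln x)) as H.
  rewrite (exp_ln x Hx) in H; lra.
Qed.

Lemma ln_lt_sub1 x : 0 < x -> x <> 1 -> ln x < x - 1.
Proof.
  intros Hx Hx1.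
  assert (Hl : ln x <> 0) by (rewrite <- ln_1; intros H; apply Hx1, ln_inv; lra).
  pose proof (exp_ineq1 (ln x) Hl) as H.
  rewrite (exp_ln x Hx) in H; lra.
Qed.

Definition bin_entropy (x : R) : R := - (x * ln x) - (1 - x) * ln (1 - x).

Lemma bin_entropy_sym x : bin_entropy (1 - x) = bin_entropy x.
Proof. unfold bin_entropy; replace (1 - (1 - x)) with x by ring; ring. Qed.

(** Gibbs' inequality: [ln u <= u - 1] at [u = b / a] and [u = (1 - b) / (1 - a)], weighted by [a]
    and [1 - a], leaves linear terms that cancel. *)
Lemma KL_bern_ge0 a b : 0 < a < 1 -> 0 < b < 1 -> 0 <= KL_bern a b.
Proof.
  intros Ha Hb; unfold KL_bern; rewrite !ln_div by lra.
  pose proof (ln_le_sub1 (b / a) ltac:(apply Rdiv_lt_0_compat; lra)) as H1.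
  pose proof (ln_le_sub1 ((1 - b) / (1 - a)) ltac:(apply Rdiv_lt_0_compat; lra)) as H2.
  rewrite ln_div in H1, H2 by lra.
  apply Rmult_le_compat_l with (r := a) in H1; [|lra].
  apply Rmult_le_compat_l with (r := 1 - a) in H2; [|lra].
  replace (a * (b / a - 1)) with (b - a) in H1 by (field; lra).
  replace ((1 - a) * ((1 - b) / (1 - a) - 1)) with (a - b) in H2 by (field; lra).
  lra.
Qed.

Lemma KL_bern_gt0 a b : 0 < a < 1 -> 0 < b < 1 -> a <> b -> 0 < KL_bern a b.
Proof.
  intros Ha Hb Hab; unfold KL_bern; rewrite !ln_div by lra.
  (* One strict logarithm inequality suffices, and [a <> b] provides it in the first term. *)
  assert (Hne : b / a <> 1).
  { intros H; apply Hab; replace b with (b / a * a) by (field; lra); rewrite H; ring. }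
  pose proof (ln_lt_sub1 (b / a) ltac:(apply Rdiv_lt_0_compat; lra) Hne) as H1.
  pose proof (ln_le_sub1 ((1 - b) / (1 - a)) ltac:(apply Rdiv_lt_0_compat; lra)) as H2.
  rewrite ln_div in H1, H2 by lra.
  apply Rmult_lt_compat_l with (r := a) in H1; [|lra].
  apply Rmult_le_compat_l with (r := 1 - a) in H2; [|lra].
  replace (a * (b / a - 1)) with (b - a) in H1 by (field; lra).
  replace ((1 - a) * ((1 - b) / (1 - a) - 1)) with (a - b) in H2 by (field; lra).
  lra.
Qed.

(* Concavity: the tangent at [x] lies above [bin_entropy a]. *)
Lemma bin_entropy_tangent a x : 0 < a < 1 -> 0 < x < 1 ->
  bin_entropy a + (x - a) * (ln (1 - x) - ln x) <= bin_entropy x.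
Proof.
  intros Ha Hx; pose proof (KL_bern_ge0 a x Ha Hx) as H.
  unfold KL_bern in H; rewrite !ln_div in H by lra; unfold bin_entropy; lra.
Qed.

(** On the left half the tangent slope at [x] is nonnegative, so moving from [a] to [x] cannot lower
    the entropy; the right half follows by symmetry. *)
Lemma bin_entropy_le a x : 0 < a <= 1/2 -> a <= x <= 1 - a ->
  bin_entropy a <= bin_entropy x.
Proof.
  intros Ha Hx.
  assert (Hhalf : forall y, a <= y <= 1/2 -> bin_entropy a <= bin_entropy y).
  { intros y Hy; pose proof (bin_entropy_tangent a y ltac:(lra) ltac:(lra)) as H.
    pose proof (ln_le y (1 - y) ltac:(lra) ltac:(lra)); nra. }
  destruct (Rle_dec x (1/2)); [apply Hhalf; lra|].
  rewrite <- (bin_entropy_sym x); apply Hhalf; lra.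
Qed.

Definition bsc_out (q r : R) : R := q * (1 - r) + (1 - q) * r.

Lemma bsc_out_bounds q r : 0 <= q <= 1 -> 0 < r < 1/2 -> r <= bsc_out q r <= 1 - r.
Proof. unfold bsc_out; nra. Qed.

(** Output entropy minus noise entropy. In this form, every comparison of mutual informations
    becomes a statement about [bin_entropy]. *)
Lemma MI_bscE q r : 0 <= q <= 1 -> 0 < r < 1/2 ->
  MI_bsc q r = bin_entropy (bsc_out q r) - bin_entropy r.
Proof.
  intros Hq Hr; pose proof (bsc_out_bounds q r Hq Hr) as H.
  unfold MI_bsc; fold (bsc_out q r); cbv zeta.
  rewrite !ln_div by lra; unfold bin_entropy.
  assert (E : bsc_out q r = q * (1 - r) + (1 - q) * r) by reflexivity.
  revert H E; generalize (bsc_out q r); intros z H E.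
  (* The occurrence numbers pick the weights [1 - z] and [z] of the output entropy; the copies
     inside logarithms stay atoms for [ring]. *)
  replace (1 - z) with (q * r + (1 - q) * (1 - r)) at 3 by (subst; ring).
  rewrite E at 5; ring.
Qed.

Lemma MI_bsc_ge0 q r : 0 <= q <= 1 -> 0 < r < 1/2 -> 0 <= MI_bsc q r.
Proof.
  intros Hq Hr; rewrite MI_bscE by assumption.
  pose proof (bin_entropy_le r (bsc_out q r) ltac:(lra) (bsc_out_bounds q r Hq Hr)); lra.
Qed.

(** The output probability [(1 + r) / 3] lies strictly between [r] and [1/2], where the tangent
    slope is positive. *)
Lemma MI_bsc_third_gt0 r : 0 < r < 1/2 -> 0 < MI_bsc (1/3) r.
Proof.
  intros Hr; rewrite MI_bscE by lra.
  assert (E : bsc_out (1/3) r = (1 + r) / 3) by (unfold bsc_out; lra).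
  rewrite E.
  pose proof (bin_entropy_tangent r ((1 + r) / 3) ltac:(lra) ltac:(lra)).
  pose proof (ln_increasing ((1 + r) / 3) (1 - (1 + r) / 3) ltac:(lra) ltac:(lra)); nra.
Qed.

(** The outputs for inputs [1/3] and [2/3] are symmetric about [1/2], so [bin_entropy_le] applies to
    every output between them. *)
Lemma MI_bsc_third_le_mid q r : 1/3 <= q <= 2/3 -> 0 < r < 1/2 ->
  MI_bsc (1/3) r <= MI_bsc q r.
Proof.
  intros Hq Hr; rewrite !MI_bscE by lra.
  pose proof (bin_entropy_le (bsc_out (1/3) r) (bsc_out q r)).
  unfold bsc_out in *; nra.
Qed.

Lemma is_derive_bin_entropy x : 0 < x < 1 ->
  is_derive bin_entropy x (ln (1 - x) - ln x).
Proof.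
  intros Hx; unfold bin_entropy; auto_derive; [lra|].
  change (1 + - x) with (1 - x); field; lra.
Qed.

(** With [h] the binary entropy, the derivative is [h'((1 + x) / 3) / 3 - h'(x)]. It is nonpositive
    because [h'] is decreasing and nonnegative up to [1/2], and [x <= (1 + x) / 3] there. *)
Lemma MI_bsc_third_decr r r0 : 0 < r <= r0 -> r0 < 1/2 ->
  MI_bsc (1/3) r0 <= MI_bsc (1/3) r.
Proof.
  intros Hr Hr0; rewrite !MI_bscE by lra.
  pose (F := fun x => bin_entropy ((1 + x) / 3) - bin_entropy x).
  pose (dF := fun x => 1/3 * (ln (1 - (1 + x) / 3) - ln ((1 + x) / 3))
                       - (ln (1 - x) - ln x)).
  assert (HF : forall x, r <= x <= r0 -> is_derive F x (dF x)).
  { intros x Hx; unfold F, dF.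
    apply (@is_derive_minus R_AbsRing R_NormedModule).
    - apply (is_derive_comp bin_entropy (fun x => (1 + x) / 3)).
      + apply is_derive_bin_entropy; lra.
      + auto_derive; [easy|lra].
    - apply is_derive_bin_entropy; lra. }
  destruct (MVT_gen F r r0 dF) as [c [Hc E]].
  - intros x Hx; apply HF; rewrite Rmin_left, Rmax_right in Hx; lra.
  - intros x Hx; rewrite Rmin_left, Rmax_right in Hx by lra.
    apply continuity_pt_filterlim.
    apply (@ex_derive_continuous R_AbsRing R_NormedModule); eexists; apply HF; lra.
  - rewrite Rmin_left, Rmax_right in Hc by lra.
    assert (dF c <= 0).
    { unfold dF.
      pose proof (ln_le c ((1 + c) / 3) ltac:(lra) ltac:(lra)).
      pose proof (ln_le (1 - (1 + c) / 3) (1 - c) ltac:(lra) ltac:(lra)).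
      pose proof (ln_le c (1 - c) ltac:(lra) ltac:(lra)).
      lra. }
    assert (E1 : bsc_out (1/3) r0 = (1 + r0) / 3) by (unfold bsc_out; lra).
    assert (E2 : bsc_out (1/3) r = (1 + r) / 3) by (unfold bsc_out; lra).
    rewrite E1, E2; unfold F in E; nra.
Qed.

Lemma C1capE r : 0 < r < 1/2 -> C1cap r = (1 - 2 * r) * ln ((1 - r) / r).
Proof.
  intros Hr; unfold C1cap, KL_bern.
  replace (1 - (1 - r)) with r by ring; rewrite !ln_div by lra; ring.
Qed.

(** * One Bayes update for a binary observation, with [w i y] an arbitrary likelihood of answer [y]
    at target [i] *)

Definition evidence (n : nat) (w : nat -> bool -> R) (pi : nat -> R) (y : bool) : R :=
  sum_range 0 n (fun j => pi j * w j y).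

Definition bayes n w (pi : nat -> R) (y : bool) : nat -> R :=
  fun i => pi i * w i y / evidence n w pi y.

Definition is_posterior (n : nat) (pi : nat -> R) : Prop :=
  (forall i, (i < n)%nat -> 0 < pi i) /\ sum_range 0 n pi = 1.

Definition entropy (n : nat) (pi : nat -> R) : R :=
  sum_range 0 n (fun i => - (pi i * ln (pi i))).

Definition log_compl_pot (n : nat) (pi : nat -> R) : R :=
  sum_range 0 n (fun i => - ln (1 - pi i)).

Lemma posterior_le_1 n pi i : is_posterior n pi -> (i < n)%nat -> pi i <= 1.
Proof.
  intros [Hpos Hsum] Hi; rewrite <- Hsum.
  apply (sumR_map_ge_term pi (seq 0 n) i).
  - apply in_seq; lia.
  - intros j Hj; apply in_seq in Hj; left; apply Hpos; lia.
Qed.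

Section BayesStep.
Context (n : nat) (w : nat -> bool -> R) (pi : nat -> R) (r : R).
Hypothesis (Hpi : is_posterior n pi) (Hr : 0 < r).
Hypothesis (Hw : forall i y, r <= w i y) (Hw1 : forall i, w i true + w i false = 1).

Let Z := evidence n w pi.
Let post := bayes n w pi.

Let pi_pos i (Hi : In i (seq 0 n)) : 0 < pi i.
Proof. apply Hpi; apply in_seq in Hi; lia. Qed.

Lemma evidence_ge y : r <= Z y.
Proof.
  replace r with (sumR (map (fun i => r * pi i) (seq 0 n))).
  - apply sumR_map_le; intros i Hi; pose proof (pi_pos i Hi); pose proof (Hw i y); nra.
  - rewrite sumR_map_scal; change (sumR (map pi (seq 0 n))) with (sum_range 0 n pi).
    rewrite (proj2 Hpi); ring.
Qed.

Lemma evidence_pos y : 0 < Z y.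
Proof. pose proof (evidence_ge y); lra. Qed.

Lemma cell_evidence_sum s :
  sumR (map (fun j => pi j * w j true) s) + sumR (map (fun j => pi j * w j false) s)
  = sumR (map pi s).
Proof.
  rewrite <- sumR_map_plus; apply sumR_map_ext; intros i _.
  rewrite <- Rmult_plus_distr_l, Hw1; ring.
Qed.

Lemma evidence_sum : Z true + Z false = 1.
Proof. unfold Z, evidence, sum_range; rewrite cell_evidence_sum; apply Hpi. Qed.

Lemma evidence_lt_1 y : Z y < 1.
Proof.
  pose proof evidence_sum; pose proof (evidence_pos true); pose proof (evidence_pos false).
  destruct y; lra.
Qed.

Lemma bayes_cell y s :
  sumR (map (post y) s) = sumR (map (fun j => pi j * w j y) s) / Z y.
Proof.
  unfold post, bayes, Rdiv; rewrite Rmult_comm, <- sumR_map_scal.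
  apply sumR_map_ext; intros; unfold Z; ring.
Qed.

Lemma bayes_posterior y : is_posterior n (post y).
Proof.
  pose proof (evidence_pos y) as HZ; split.
  - intros i Hi; apply Rdiv_lt_0_compat; [|exact HZ].
    apply Rmult_lt_0_compat; [now apply Hpi|pose proof (Hw i y); lra].
  - unfold sum_range; rewrite bayes_cell.
    change (Z y / Z y = 1); field; lra.
Qed.

(* The increase of the second moment of the mass of a cell is the variance of the
   updated mass. *)
Lemma bayes_cell_sqr s :
  sumR (map pi s) ^ 2
  + (sumR (map (fun j => pi j * w j true) s) - sumR (map pi s) * Z true) ^ 2
  <= Z true * sumR (map (post true) s) ^ 2 + Z false * sumR (map (post false) s) ^ 2.
Proof.
  rewrite !bayes_cell.
  pose proof (cell_evidence_sum s) as Hm; pose proof evidence_sum as HZ.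
  pose proof (evidence_pos true) as Ht; pose proof (evidence_pos false) as Hf.
  revert Hm HZ Ht Hf.
  generalize (sumR (map (fun j => pi j * w j true) s)), (Z true), (Z false).
  generalize (sumR (map (fun j => pi j * w j false) s)), (sumR (map pi s)).
  intros b m a zt zf Hm HZ Ht Hf.
  replace b with (m - a) by lra; replace zf with (1 - zt) in * by lra.
  apply Rminus_le_0.
  (* The exact variance is [(a - m * zt) ^ 2 / (zt * (1 - zt))]; its denominator is at most 1, and
     only the numerator is kept. *)
  replace (_ - _) with ((a - m * zt) ^ 2 * (/ zt * / (1 - zt) - 1)) by (field; lra).
  apply Rmult_le_pos; [apply pow2_ge_0|].
  assert (1 <= / zt) by (rewrite <- Rinv_1; apply Rinv_le_contravar; lra).
  assert (1 <= / (1 - zt)) by (rewrite <- Rinv_1; apply Rinv_le_contravar; lra).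
  nra.
Qed.

(** The unnormalised mass outside [i] keeps at least a fraction [r], and dividing by an evidence
    below 1 only increases it. This limits how far one observation can overshoot the stopping
    threshold. *)
Lemma bayes_compl y i : (i < n)%nat -> r * (1 - pi i) <= 1 - post y i.
Proof.
  intros Hi; pose proof (evidence_pos y) as HZ; pose proof (evidence_lt_1 y) as HZ1.
  assert (H : pi i * (w i y - r) <= Z y - r).
  { replace (Z y - r) with (sumR (map (fun j => pi j * (w j y - r)) (seq 0 n))).
    - apply (sumR_map_ge_term (fun j => pi j * (w j y - r))); [apply in_seq; lia|].
      intros j Hj; pose proof (pi_pos j Hj); pose proof (Hw j y); nra.
    - rewrite (sumR_map_ext _ (fun j => pi j * w j y + - r * pi j)) by (intros; ring).
      rewrite sumR_map_plus, sumR_map_scal.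
      change (sumR (map pi (seq 0 n))) with (sum_range 0 n pi); rewrite (proj2 Hpi).
      unfold Z, evidence, sum_range; ring. }
  unfold post, bayes; fold Z.
  replace (1 - pi i * w i y / Z y) with ((Z y - pi i * w i y) / Z y) by (field; lra).
  apply (Rle_div_r _ _ _ HZ).
  pose proof (posterior_le_1 n pi i Hpi Hi).
  assert (0 <= r * (1 - pi i) * (1 - Z y)) by (apply Rmult_le_pos; nra).
  lra.
Qed.

(** Jensen's inequality for the convex function [- ln (1 - x)]: the posterior of [i] is a
    martingale, and the tangent of [ln] at [1 - pi i] gives the bound. *)
Lemma bayes_log_compl i : (i < n)%nat -> pi i < 1 ->
  - ln (1 - pi i) <=
  Z true * - ln (1 - post true i) + Z false * - ln (1 - post false i).
Proof.
  intros Hi Hi1.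
  assert (H : forall y, 0 < 1 - post y i).
  { intros y; pose proof (bayes_compl y i Hi); nra. }
  pose proof (cell_evidence_sum (i :: nil)) as Hm; simpl in Hm; rewrite !Rplus_0_r in Hm.
  assert (E : forall y, Z y * post y i = pi i * w i y).
  { intros y; pose proof (evidence_pos y); unfold post, bayes; fold Z; field; lra. }
  pose proof (E true); pose proof (E false).
  assert (G : forall y, Z y * ln (1 - post y i) <=
                        Z y * (ln (1 - pi i) + ((1 - post y i) / (1 - pi i) - 1))).
  { intros y; apply Rmult_le_compat_l; [left; apply evidence_pos|].
    pose proof (ln_le_sub1 ((1 - post y i) / (1 - pi i))
                  ltac:(apply Rdiv_lt_0_compat; [apply H|lra])) as G.
    rewrite ln_div in G; [lra|apply H|lra]. }
  pose proof (G true); pose proof (G false); pose proof evidence_sum as HZ.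
  assert (K : Z true * ((1 - post true i) / (1 - pi i) - 1)
              + Z false * ((1 - post false i) / (1 - pi i) - 1) = 0).
  { replace (_ + _) with ((Z true + Z false - (Z true * post true i + Z false * post false i))
        / (1 - pi i) - (Z true + Z false)) by (field; lra).
    rewrite !E, HZ, Hm; field; lra. }
  replace (ln (1 - pi i)) with ((Z true + Z false) * ln (1 - pi i)) by (rewrite HZ; ring).
  lra.
Qed.

(** Chain rule: the mean posterior entropy is the prior entropy minus the entropy of the answer plus
    its conditional entropy given the target. *)
Lemma bayes_entropy :
  Z true * entropy n (post true) + Z false * entropy n (post false) =
  entropy n pi - bin_entropy (Z true)
  - (sum_range 0 n (fun i => pi i * (w i true * ln (w i true)))
     + sum_range 0 n (fun i => pi i * (w i false * ln (w i false)))).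
Proof.
  assert (E : forall y, Z y * entropy n (post y) =
     sum_range 0 n (fun i => - (pi i * ln (pi i)) * w i y)
     - sum_range 0 n (fun i => pi i * (w i y * ln (w i y))) + Z y * ln (Z y)).
  { intros y; pose proof (evidence_pos y) as HZ; unfold entropy, sum_range.
    rewrite <- sumR_map_scal.
    rewrite (sumR_map_ext _ (fun i => (- (pi i * ln (pi i)) * w i y
        + -1 * (pi i * (w i y * ln (w i y)))) + ln (Z y) * (pi i * w i y))).
    - rewrite !sumR_map_plus, !sumR_map_scal.
      change (sumR (map (fun x => pi x * w x y) (seq 0 n))) with (Z y); ring.
    - intros i Hi; pose proof (pi_pos i Hi); pose proof (Hw i y).
      unfold post, bayes; fold Z.
      assert (0 < w i y) by lra; assert (0 < pi i * w i y) by nra.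
      rewrite ln_div, ln_mult by assumption; field; lra. }
  rewrite !E; clear E.
  assert (E : sum_range 0 n (fun i => - (pi i * ln (pi i)) * w i true)
              + sum_range 0 n (fun i => - (pi i * ln (pi i)) * w i false) = entropy n pi).
  { unfold sum_range, entropy; rewrite <- sumR_map_plus; apply sumR_map_ext.
    intros i _; rewrite <- Rmult_plus_distr_l, Hw1; ring. }
  rewrite <- E; unfold bin_entropy.
  pose proof evidence_sum; replace (1 - Z true) with (Z false) by lra; ring.
Qed.

End BayesStep.

Lemma entropy_ge0 n pi : is_posterior n pi -> 0 <= entropy n pi.
Proof.
  intros Hpi; apply sumR_map_nonneg; intros i Hi; apply in_seq in Hi.
  pose proof (proj1 Hpi i ltac:(lia)); pose proof (posterior_le_1 n pi i Hpi ltac:(lia)).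
  pose proof (ln_le_sub1 (pi i)); nra.
Qed.

(** Each term is at most [(b + 1) * pi i], so the bound does not grow with the number of items. *)
Lemma log_compl_pot_le n pi b : is_posterior n pi ->
  (forall i, (i < n)%nat -> pi i < 1 /\ - ln (1 - pi i) <= b) ->
  log_compl_pot n pi <= b + 1.
Proof.
  intros Hpi H.
  replace (b + 1) with (sumR (map (fun i => (b + 1) * pi i) (seq 0 n))).
  2: { rewrite sumR_map_scal; change (sumR (map pi (seq 0 n))) with (sum_range 0 n pi).
       rewrite (proj2 Hpi); ring. }
  apply sumR_map_le; intros i Hi; apply in_seq in Hi.
  destruct (H i ltac:(lia)) as [H1 H2]; pose proof (proj1 Hpi i ltac:(lia)) as H0.
  (* [- ln (1 - x) <= x / (1 - x)] rearranges to [- ln (1 - x) <= x * (1 - ln (1 - x))]. *)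
  pose proof (ln_le_sub1 (/ (1 - pi i)) ltac:(apply Rinv_0_lt_compat; lra)) as G.
  rewrite ln_Rinv in G by lra.
  apply Rmult_le_compat_l with (r := 1 - pi i) in G; [|lra].
  replace ((1 - pi i) * (/ (1 - pi i) - 1)) with (pi i) in G by (field; lra).
  nra.
Qed.

(** * Dyadic cells and the effect of querying one of them *)

Lemma Nitems_split L l : (l <= L)%nat -> Nitems L = (Nat.pow 2 l * Hsize L l)%nat.
Proof.
  intros Hl; unfold Nitems, Hsize; rewrite <- Nat.pow_add_r; f_equal; lia.
Qed.

Lemma cell_in_range L l m : (l <= L)%nat -> (m < Nat.pow 2 l)%nat ->
  (m * Hsize L l + Hsize L l <= Nitems L)%nat.
Proof. intros Hl Hm; rewrite (Nitems_split L l Hl); nia. Qed.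

Lemma inH_true L l m i :
  inH L l m i = true <-> (m * Hsize L l <= i < m * Hsize L l + Hsize L l)%nat.
Proof.
  unfold inH; rewrite Bool.andb_true_iff, Nat.leb_le, Nat.ltb_lt; lia.
Qed.

Lemma sum_range_inH L l m pi : (l <= L)%nat -> (m < Nat.pow 2 l)%nat ->
  sum_range 0 (Nitems L) (fun i => if inH L l m i then pi i else 0) = Hmass L pi l m.
Proof.
  intros Hl Hm; pose proof (cell_in_range L l m Hl Hm) as Hr.
  set (a := (m * Hsize L l)%nat) in *; set (s := Hsize L l) in *.
  replace (Nitems L) with (a + (s + (Nitems L - a - s)))%nat by lia.
  rewrite !sum_range_split.
  assert (E0 : forall b k, (forall i, (b <= i < b + k)%nat -> inH L l m i = false) ->
            sum_range b k (fun i => if inH L l m i then pi i else 0) = 0).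
  { intros b k H; unfold sum_range; rewrite (sumR_map_ext _ (fun _ => 0)).
    - rewrite sumR_map_const; ring.
    - intros i Hi; apply in_seq in Hi; now rewrite H. }
  assert (F : forall i, ~ (a <= i < a + s)%nat -> inH L l m i = false).
  { intros i Hi; apply Bool.not_true_iff_false; rewrite inH_true; exact Hi. }
  rewrite (E0 0%nat a), (E0 (0 + a + s)%nat); try (intros; apply F; lia).
  rewrite Rplus_0_l, Rplus_0_r; apply sumR_map_ext; intros i Hi; apply in_seq in Hi.
  assert (HT : inH L l m i = true) by (apply inH_true; fold s a; lia).
  now rewrite HT.
Qed.

Lemma chan_sum p L q i : chan p L q i true + chan p L q i false = 1.
Proof. unfold chan; destruct (inH L (fst q) (snd q) i); simpl; ring. Qed.

Definition noise (p : R -> R) (L l : nat) : R := p (INR (Hsize L l) * delta L).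

Section QueryStep.
Context (p : R -> R) (L l m : nat) (pi : nat -> R).
Hypothesis (Hl : (l <= L)%nat) (Hm : (m < Nat.pow 2 l)%nat).
Hypothesis Hpi : is_posterior (Nitems L) pi.
Hypothesis Hr : 0 < noise p L l < 1/2.

Let r := noise p L l.
Let w := chan p L (l, m).
Let q := Hmass L pi l m.
Let Z := evidence (Nitems L) w pi.
Let post := bayes (Nitems L) w pi.

(** The channel sees the target only through membership in the queried cell, so all its averages
    reduce to two values. *)
Lemma sum_range_cell_fun (g : bool -> R) :
  sum_range 0 (Nitems L) (fun i => pi i * g (inH L l m i)) = q * g true + (1 - q) * g false.
Proof.
  unfold q; rewrite <- (sum_range_inH L l m pi Hl Hm); unfold sum_range.
  rewrite (sumR_map_ext _ (fun i => g false * pi i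
     + (g true - g false) * (if inH L l m i then pi i else 0))).
  - rewrite sumR_map_plus, !sumR_map_scal.
    change (sumR (map pi (seq 0 (Nitems L)))) with (sum_range 0 (Nitems L) pi).
    rewrite (proj2 Hpi); ring.
  - intros i _; destruct (inH L l m i); ring.
Qed.

Lemma chan_ge i y : r <= w i y.
Proof.
  unfold w, chan; simpl; fold (noise p L l); fold r; unfold r in *.
  destruct (Bool.eqb y (inH L l m i)); lra.
Qed.

Lemma query_evidence : Z true = bsc_out q r.
Proof.
  unfold Z, evidence, w, chan; cbn [fst snd]; fold (noise p L l); fold r.
  rewrite (sum_range_cell_fun (fun b => if Bool.eqb true b then 1 - r else r)).
  simpl; unfold bsc_out; ring.
Qed.

Lemma Hmass_bounds : 0 <= q <= 1.
Proof.
  unfold q; pose proof (cell_in_range L l m Hl Hm); split.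
  - apply sumR_map_nonneg; intros i Hi; apply in_seq in Hi; left; apply Hpi; lia.
  - rewrite <- (sum_range_inH L l m pi Hl Hm), <- (proj2 Hpi).
    apply sumR_map_le; intros i Hi; apply in_seq in Hi.
    pose proof (proj1 Hpi i ltac:(lia)); destruct inH; lra.
Qed.

(** Given the target, the answer has entropy [bin_entropy r] whatever the cell, so the chain rule
    leaves exactly the mutual information. *)
Lemma query_entropy :
  Z true * entropy (Nitems L) (post true) + Z false * entropy (Nitems L) (post false)
  = entropy (Nitems L) pi - MI_bsc q r.
Proof.
  unfold Z, post; rewrite (bayes_entropy _ w pi r Hpi (proj1 Hr) chan_ge (chan_sum p L (l, m))).
  fold Z; rewrite query_evidence, (MI_bscE q r Hmass_bounds Hr).
  unfold w, chan; cbn [fst snd]; fold (noise p L l); fold r.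
  rewrite (sum_range_cell_fun (fun b => (if Bool.eqb true b then 1 - r else r)
                                 * ln (if Bool.eqb true b then 1 - r else r))).
  rewrite (sum_range_cell_fun (fun b => (if Bool.eqb false b then 1 - r else r)
                                 * ln (if Bool.eqb false b then 1 - r else r))).
  simpl; unfold bin_entropy; ring.
Qed.

(** For the queried cell the deviation in the variance bound is [q * (1 - r) - q * bsc_out q r],
    which factors as [q * (1 - q) * (1 - 2 * r)]. *)
Lemma query_Hmass_sqr :
  q ^ 2 + (q * (1 - q) * (1 - 2 * r)) ^ 2 <=
  Z true * Hmass L (post true) l m ^ 2 + Z false * Hmass L (post false) l m ^ 2.
Proof.
  eapply Rle_trans;
    [|apply (bayes_cell_sqr _ w pi r Hpi (proj1 Hr) chan_ge (chan_sum p L (l, m)))].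
  fold Z; rewrite query_evidence; fold (sum_range (m * Hsize L l) (Hsize L l) pi).
  fold (Hmass L pi l m); fold q.
  rewrite (sumR_map_ext _ (fun j => (1 - r) * pi j)).
  - rewrite sumR_map_scal; fold (sum_range (m * Hsize L l) (Hsize L l) pi).
    fold (Hmass L pi l m); fold q; unfold bsc_out; apply Req_le; ring.
  - intros i Hi; apply in_seq in Hi; unfold w, chan; cbn [fst snd].
    rewrite (proj2 (inH_true L l m i)) by lia; simpl; fold (noise p L l); fold r; ring.
Qed.

End QueryStep.

Lemma Hsize_leaf L : Hsize L L = 1%nat.
Proof. unfold Hsize; now rewrite Nat.sub_diag. Qed.

Lemma Hmass_leaf L pi m : Hmass L pi L m = pi m.
Proof.
  unfold Hmass, sum_range; rewrite Hsize_leaf, Nat.mul_1_r; simpl; ring.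
Qed.

(** Bayes' rule multiplies [1 - pi m] by [r / Z true] after a positive answer and by
    [(1 - r) / Z false] after a negative one; the mean log-ratio is a divergence. *)
Lemma query_leaf_log_compl p L m pi : (m < Nitems L)%nat ->
  is_posterior (Nitems L) pi -> 0 < noise p L L < 1/2 -> pi m < 1 ->
  let w := chan p L (L, m) in
  let Z := evidence (Nitems L) w pi in
  let post := bayes (Nitems L) w pi in
  - ln (1 - pi m) + C1cap (noise p L L) * (2 * pi m - 1) <=
  Z true * - ln (1 - post true m) + Z false * - ln (1 - post false m).
Proof.
  intros Hm Hpi Hr H1 w Z post.
  pose proof (proj1 Hpi m Hm) as H0.
  pose proof (query_evidence p L L m pi (le_n L) Hm Hpi) as Et.
  fold w in Et; fold Z in Et; rewrite Hmass_leaf in Et.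
  assert (Ef : Z false = 1 - Z true).
  { pose proof (evidence_sum (Nitems L) w pi Hpi (chan_sum p L (L, m))) as E.
    fold Z in E; lra. }
  set (r := noise p L L) in *; set (x := pi m) in *.
  pose proof (bsc_out_bounds x r ltac:(lra) Hr) as HZ; rewrite <- Et in HZ.
  assert (Hin : inH L L m m = true) by (apply inH_true; rewrite Hsize_leaf; lia).
  assert (Pt : 1 - post true m = (1 - x) * r / Z true).
  { unfold post, bayes; fold Z; unfold w, chan; cbn [fst snd]; rewrite Hin; simpl.
    fold (noise p L L); fold r x.
    replace ((1 - x) * r) with (Z true - x * (1 - r)) by (rewrite Et; unfold bsc_out; ring).
    field; lra. }
  assert (Pf : 1 - post false m = (1 - x) * (1 - r) / Z false).
  { unfold post, bayes; fold Z; unfold w, chan; cbn [fst snd]; rewrite Hin; simpl.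
    fold (noise p L L); fold r x.
    replace ((1 - x) * (1 - r)) with (Z false - x * r)
      by (rewrite Ef, Et; unfold bsc_out; ring).
    field; lra. }
  rewrite Pt, Pf, Ef, !ln_div, !ln_mult by nra.
  (* The gain is [KL_bern (Z true) r], which exceeds its lower bound
     [C1cap r * (2 * x - 1)] by [KL_bern (Z true) (1 - r)]. *)
  pose proof (KL_bern_ge0 (Z true) (1 - r) ltac:(lra) ltac:(lra)) as K.
  unfold KL_bern in K; replace (1 - (1 - r)) with r in K by ring.
  rewrite !ln_div in K by lra.
  rewrite C1capE, ln_div by lra.
  assert (E2 : (1 - 2 * r) * (2 * x - 1) = 2 * Z true - 1)
    by (rewrite Et; unfold bsc_out; ring).
  replace ((1 - 2 * r) * (ln (1 - r) - ln r) * (2 * x - 1))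
    with ((2 * Z true - 1) * (ln (1 - r) - ln r)) by (rewrite <- E2; ring).
  lra.
Qed.

(** * Cells selected by the hierarchical strategy *)

Lemma Hmass_children L pi l m : (l < L)%nat ->
  Hmass L pi (S l) (2 * m) + Hmass L pi (S l) (2 * m + 1) = Hmass L pi l m.
Proof.
  intros Hl; unfold Hmass.
  assert (E : Hsize L l = (Hsize L (S l) + Hsize L (S l))%nat).
  { unfold Hsize; replace (L - l)%nat with (S (L - S l)) by lia; simpl; lia. }
  rewrite E, sum_range_split; f_equal; f_equal; lia.
Qed.

(** Level 0 is returned as a default, without a test, hence the positivity guard in the second
    clause. *)
Lemma lstar_aux_spec L pi k :
  (lstar_aux L pi k <= k)%nat /\
  ((0 < lstar_aux L pi k)%nat -> 1/2 <= levelmax L pi (lstar_aux L pi k)) /\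
  (forall j, (lstar_aux L pi k < j <= k)%nat -> levelmax L pi j < 1/2).
Proof.
  induction k as [|k [IH1 [IH2 IH3]]]; cbn [lstar_aux].
  - split; [lia|split; intros; lia].
  - destruct (Rle_dec (1/2) (levelmax L pi (S k))) as [H|H].
    + split; [lia|split; [easy|intros; lia]].
    + split; [lia|split; [easy|]]; intros j Hj.
      destruct (Nat.eq_dec j (S k)) as [->|Hne]; [lra|apply IH3; lia].
Qed.

Lemma argmax_aux_spec f s best :
  In (argmax_aux f s best) (best :: s) /\
  forall x, In x (best :: s) -> f x <= f (argmax_aux f s best).
Proof.
  revert best; induction s as [|a s IH]; intros best; cbn [argmax_aux].
  - split; [now left|intros x [->|[]]; lra].
  - destruct (Rlt_dec (f best) (f a)) as [H|H];
      [destruct (IH a) as [I1 I2]|destruct (IH best) as [I1 I2]].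
    + split; [now right|intros x [<-|Hx]; [|now apply I2]].
      pose proof (I2 a (or_introl eq_refl)); lra.
    + split; [destruct I1 as [I1|I1]; [now left|now right; right]|].
      intros x [<-|[<-|Hx]]; [apply I2; now left| |apply I2; now right].
      pose proof (I2 best (or_introl eq_refl)); lra.
Qed.

Lemma argmin_aux_spec g s best :
  In (argmin_aux g s best) (best :: s) /\
  forall x, In x (best :: s) -> g (argmin_aux g s best) <= g x.
Proof.
  revert best; induction s as [|a s IH]; intros best; cbn [argmin_aux].
  - split; [now left|intros x [->|[]]; lra].
  - destruct (Rlt_dec (g a) (g best)) as [H|H];
      [destruct (IH a) as [I1 I2]|destruct (IH best) as [I1 I2]].
    + split; [now right|intros x [<-|Hx]; [|now apply I2]].
      pose proof (I2 a (or_introl eq_refl)); lra.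
    + split; [destruct I1 as [I1|I1]; [now left|now right; right]|].
      intros x [<-|[<-|Hx]]; [apply I2; now left| |apply I2; now right].
      pose proof (I2 best (or_introl eq_refl)); lra.
Qed.

Lemma Hmass_le_levelmax L pi l m : (m < Nat.pow 2 l)%nat ->
  Hmass L pi l m <= levelmax L pi l.
Proof. intros Hm; apply le_fold_Rmax, in_seq; lia. Qed.

Section HiePM.
Context (L : nat) (pi : nat -> R).
Hypotheses (HL : (0 < L)%nat) (Hpi : is_posterior (Nitems L) pi).

(** The two halves at level 1 have total mass 1, so one of them reaches [1/2]. Consequently the
    whole range, whose noise would be [p] at 1, is never queried. *)
Lemma lstar_bounds : (0 < lstar L pi <= L)%nat.
Proof.
  destruct (lstar_aux_spec L pi L) as [H1 [_ H3]]; fold (lstar L pi) in *.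
  split; [|exact H1]; destruct (Nat.eq_dec (lstar L pi) 0) as [E|]; [exfalso|lia].
  pose proof (H3 1%nat ltac:(lia)) as H.
  pose proof (Hmass_le_levelmax L pi 1 0 ltac:(simpl; lia)).
  pose proof (Hmass_le_levelmax L pi 1 1 ltac:(simpl; lia)).
  pose proof (Hmass_children L pi 0 0 HL) as Hc; simpl in Hc.
  assert (Hmass L pi 0 0 = 1); [|lra].
  unfold Hmass; rewrite <- (proj2 Hpi).
  now rewrite (Nitems_split L 0), Nat.mul_1_l, Nat.mul_0_l by lia.
Qed.

Lemma mstar_spec : (mstar L pi < Nat.pow 2 (lstar L pi))%nat /\
  1/2 <= Hmass L pi (lstar L pi) (mstar L pi).
Proof.
  pose proof lstar_bounds as Hl.
  destruct (lstar_aux_spec L pi L) as [_ [H2 _]]; fold (lstar L pi) in *.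
  specialize (H2 ltac:(lia)).
  pose proof (Nat.pow_nonzero 2 (lstar L pi)).
  destruct (argmax_aux_spec (Hmass L pi (lstar L pi))
              (seq 1 (Nat.pow 2 (lstar L pi) - 1)) 0) as [I1 I2].
  fold (mstar L pi) in I1, I2; split.
  - destruct I1 as [<-|I1]; [lia|apply in_seq in I1; lia].
  - eapply Rle_trans; [exact H2|]; apply fold_Rmax_le.
    (* The maximum is folded from 0, so nonnegativity of the selected mass is a separate
       obligation. *)
    + assert (Hm : (mstar L pi < Nat.pow 2 (lstar L pi))%nat)
        by (destruct I1 as [<-|I1]; [lia|apply in_seq in I1; lia]).
      apply (Hmass_bounds L (lstar L pi) (mstar L pi) pi); try assumption; lia.
    + intros x Hx; apply in_seq in Hx; apply I2.
      destruct x; [now left|right; apply in_seq; lia].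
Qed.

(** Before the last level, the selected parent has mass at least [1/2] and, by maximality of its
    level, both children have less. If the parent exceeds [2/3], one child is at least [1/3]; either
    way some candidate is within [1/6] of [1/2]. *)
Lemma hiePM_query_spec :
  let lq := fst (hiePM_query L pi) in
  let mq := snd (hiePM_query L pi) in
  (0 < lq <= L)%nat /\ (mq < Nat.pow 2 lq)%nat /\ (lstar L pi <= lq <= S (lstar L pi))%nat /\
  ((lstar L pi < L)%nat -> 1/3 <= Hmass L pi lq mq <= 2/3) /\
  (lstar L pi = L -> 1/2 <= Hmass L pi lq mq).
Proof.
  pose proof lstar_bounds as Hl; destruct mstar_spec as [Hm Hhalf].
  unfold hiePM_query; destruct (Nat.ltb_spec (lstar L pi) L) as [HlL|HlL].
  - set (g := fun c => Rabs (Hmass L pi (fst c) (snd c) - 1/2)).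
    destruct (argmin_aux_spec g ((S (lstar L pi), (2 * mstar L pi)%nat)
      :: (S (lstar L pi), (2 * mstar L pi + 1)%nat) :: nil) (lstar L pi, mstar L pi))
      as [I1 I2].
    destruct (lstar_aux_spec L pi L) as [_ [_ H3]]; fold (lstar L pi) in H3.
    specialize (H3 (S (lstar L pi)) ltac:(lia)).
    assert (Hc : (2 * mstar L pi + 1 < Nat.pow 2 (S (lstar L pi)))%nat)
      by (rewrite Nat.pow_succ_r'; lia).
    pose proof (Hmass_le_levelmax L pi (S (lstar L pi)) (2 * mstar L pi) ltac:(lia)).
    pose proof (Hmass_le_levelmax L pi (S (lstar L pi)) (2 * mstar L pi + 1) Hc).
    pose proof (Hmass_children L pi (lstar L pi) (mstar L pi) HlL).
    pose proof (I2 _ (or_introl eq_refl)) as G0.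
    pose proof (I2 _ (or_intror (or_introl eq_refl))) as G1.
    pose proof (I2 _ (or_intror (or_intror (or_introl eq_refl)))) as G2.
    revert I1 G0 G1 G2.
    match goal with |- In ?t _ -> _ => generalize t end; intros [lq mq] I1 G0 G1 G2.
    assert (Hg : g (lq, mq) <= 1/6).
    { unfold g in G0, G1, G2 |- *; cbn [fst snd] in *.
      destruct (Rle_dec (Hmass L pi (lstar L pi) (mstar L pi)) (2/3)).
      - eapply Rle_trans; [exact G0|apply Rabs_le; lra].
      - destruct (Rle_dec (1/3) (Hmass L pi (S (lstar L pi)) (2 * mstar L pi))).
        + eapply Rle_trans; [exact G1|apply Rabs_le; lra].
        + eapply Rle_trans; [exact G2|apply Rabs_le; lra]. }
    unfold g in Hg; cbn [fst snd] in *; apply Rabs_le_between in Hg.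
    assert (Hmid : 1/3 <= Hmass L pi lq mq <= 2/3) by lra.
    repeat split; try lra; try lia;
      destruct I1 as [E|[E|[E|[]]]]; injection E as <- <-; lia.
  - cbn [argmin_aux fst snd]; repeat split; try lia; try assumption; intros; exact Hhalf.
Qed.

End HiePM.

(** * Second moments of the cell masses *)

Lemma sumR_map_le_gap {A} (f g : A -> R) s x d :
  In x s -> (forall y, In y s -> f y <= g y) -> f x + d <= g x ->
  sumR (map f s) + d <= sumR (map g s).
Proof.
  intros Hx Hle Hd.
  pose proof (sumR_map_ge_term (fun y => g y + -1 * f y) s x Hx) as H.
  rewrite sumR_map_plus, sumR_map_scal in H.
  assert (Hn : forall y, In y s -> 0 <= g y + -1 * f y)
    by (intros y Hy; pose proof (Hle y Hy); lra).
  specialize (H Hn); cbv beta in H; lra.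
Qed.

Lemma posterior_lt_1 n pi i : (1 < n)%nat -> is_posterior n pi -> (i < n)%nat -> pi i < 1.
Proof.
  intros Hn [Hpos Hsum] Hi.
  replace n with (i + (1 + (n - i - 1)))%nat in Hsum by lia.
  rewrite !sum_range_split in Hsum.
  assert (Hge : forall a k j, (a + k <= n)%nat -> (a <= j < a + k)%nat ->
            pi j <= sum_range a k pi).
  { intros a k j Hk Hj; apply sumR_map_ge_term; [apply in_seq; lia|].
    intros u Hu; apply in_seq in Hu; left; apply Hpos; lia. }
  assert (Hge0 : forall a k, (a + k <= n)%nat -> 0 <= sum_range a k pi).
  { intros a k Hk; apply sumR_map_nonneg.
    intros u Hu; apply in_seq in Hu; left; apply Hpos; lia. }
  pose proof (Hge0 0%nat i ltac:(lia)); pose proof (Hge0 (0 + i + 1)%nat (n - i - 1)%nat ltac:(lia)).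
  pose proof (Hge (0 + i)%nat 1%nat i ltac:(lia) ltac:(lia)).
  (* A second index carries positive mass: 1 when [i] is 0, and 0 otherwise. *)
  destruct i as [|i].
  - pose proof (Hge (0 + 0 + 1)%nat (n - 0 - 1)%nat 1%nat ltac:(lia) ltac:(lia)).
    pose proof (Hpos 1%nat ltac:(lia)); lra.
  - pose proof (Hge 0%nat (S i) 0%nat ltac:(lia) ltac:(lia)).
    pose proof (Hpos 0%nat ltac:(lia)); lra.
Qed.

Definition level_sqr (L : nat) (pi : nat -> R) (l : nat) : R :=
  sum_range 0 (Nat.pow 2 l) (fun m => Hmass L pi l m ^ 2).

Definition upper_sqr (L : nat) (pi : nat -> R) (k : nat) : R :=
  sum_range 0 (S k) (level_sqr L pi).

(** The level [k] will be truncated at [L], while the bound uses [k'] alone and is therefore uniform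
    in [L]. *)
Lemma upper_sqr_le L pi k k' : (k <= L)%nat -> (k <= k')%nat ->
  is_posterior (Nitems L) pi -> upper_sqr L pi k <= INR (S k') * 2 ^ k'.
Proof.
  intros HkL Hk Hpi.
  assert (Hlev : forall l, (l <= k)%nat -> level_sqr L pi l <= 2 ^ k').
  { intros l Hl; apply Rle_trans with (2 ^ l); [|apply Rle_pow; [lra|lia]].
    replace (2 ^ l) with (sumR (map (fun _ => 1) (seq 0 (Nat.pow 2 l)))).
    - apply sumR_map_le; intros m Hm; apply in_seq in Hm.
      pose proof (Hmass_bounds L l m pi ltac:(lia) ltac:(lia) Hpi); nra.
    - rewrite sumR_map_const, length_seq, pow_INR; replace (INR 2) with 2 by (simpl; ring); ring. }
  apply Rle_trans with (sumR (map (fun _ => 2 ^ k') (seq 0 (S k)))).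
  - apply sumR_map_le; intros l Hl; apply in_seq in Hl; apply Hlev; lia.
  - rewrite sumR_map_const, length_seq; apply Rmult_le_compat_r.
    + apply pow_le; lra.
    + apply le_INR; lia.
Qed.

(** Leaf masses are the posterior itself and satisfy [x ^ 2 <= x]; this avoids the factor [2 ^ L] of
    the crude count. *)
Lemma level_sqr_leaf_le_1 L pi : is_posterior (Nitems L) pi -> level_sqr L pi L <= 1.
Proof.
  intros Hpi; rewrite <- (proj2 Hpi); apply sumR_map_le; intros i Hi; apply in_seq in Hi.
  rewrite Hmass_leaf; pose proof (proj1 Hpi i ltac:(lia)).
  pose proof (posterior_le_1 _ pi i Hpi ltac:(lia)); nra.
Qed.

(** * One-step conditional means of the potentials, with noise between [r0] and [r1] (later
    [p[delta]] and [p[1/2]]) *)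

Definition step_mean (p : R -> R) (L : nat) (pi : nat -> R) (F : (nat -> R) -> R) : R :=
  let w := chan p L (hiePM_query L pi) in
  evidence (Nitems L) w pi true * F (update p L pi true)
  + evidence (Nitems L) w pi false * F (update p L pi false).

Section Drift.
Context (p : R -> R) (L : nat) (r0 r1 : R) (pi : nat -> R).
Hypotheses (HL : (0 < L)%nat) (Hr0 : 0 < r0) (Hr1 : r1 < 1/2).
Hypothesis Hnoise : forall l, (0 < l <= L)%nat -> r0 <= noise p L l <= r1.
Hypothesis HnoiseL : noise p L L = r0.
Hypothesis Hpi : is_posterior (Nitems L) pi.

Let lq := fst (hiePM_query L pi).
Let mq := snd (hiePM_query L pi).
Let w := chan p L (hiePM_query L pi).

Let lq_bounds : (0 < lq <= L)%nat.
Proof. now destruct (hiePM_query_spec L pi HL Hpi). Qed.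

Let mq_bound : (mq < Nat.pow 2 lq)%nat.
Proof. now destruct (hiePM_query_spec L pi HL Hpi) as [_ [H _]]. Qed.

Let wE : w = chan p L (lq, mq).
Proof. unfold w, lq, mq; now rewrite <- surjective_pairing. Qed.

Let noise_range : 0 < noise p L lq < 1/2.
Proof. pose proof (Hnoise lq lq_bounds); lra. Qed.

Let w_ge i y : r0 <= w i y.
Proof.
  rewrite wE; eapply Rle_trans; [apply (Hnoise lq lq_bounds)|].
  apply chan_ge; exact noise_range.
Qed.

Let w_sum i : w i true + w i false = 1.
Proof. apply chan_sum. Qed.

Lemma Nitems_gt_1 : (1 < Nitems L)%nat.
Proof. unfold Nitems; apply Nat.pow_gt_1; lia. Qed.

Lemma update_posterior y : is_posterior (Nitems L) (update p L pi y).
Proof. exact (bayes_posterior _ w pi r0 Hpi Hr0 w_ge y). Qed.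

(** While the search runs, every [1 - pi i] is at least [eps], and one observation shrinks it at
    most by the factor [r0]. The bound thus covers the stopping posterior too. *)
Lemma update_log_compl_pot y eps : 0 < eps < 1 ->
  (forall i, (i < Nitems L)%nat -> pi i <= 1 - eps) ->
  log_compl_pot (Nitems L) (update p L pi y) <= ln (1 / eps) + ln (1 / r0) + 1.
Proof.
  intros He Hrun; apply log_compl_pot_le; [apply update_posterior|].
  intros i Hi; pose proof (Hrun i Hi) as Hx.
  pose proof (bayes_compl _ w pi r0 Hpi Hr0 w_ge w_sum y i Hi) as H.
  change (bayes (Nitems L) w pi y i) with (update p L pi y i) in H.
  assert (Hc : eps * r0 <= 1 - update p L pi y i) by nra.
  split; [nra|].
  rewrite !ln_div, !ln_1 by lra.
  pose proof (ln_le (eps * r0) (1 - update p L pi y i) ltac:(nra) Hc) as G.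
  rewrite ln_mult in G by lra; lra.
Qed.

Lemma step_entropy :
  step_mean p L pi (entropy (Nitems L)) =
  entropy (Nitems L) pi - MI_bsc (Hmass L pi lq mq) (noise p L lq).
Proof.
  unfold step_mean; cbv zeta; fold w.
  change (update p L pi) with (bayes (Nitems L) w pi); rewrite wE.
  apply query_entropy; try assumption; apply lq_bounds.
Qed.

Lemma step_entropy_le : step_mean p L pi (entropy (Nitems L)) <= entropy (Nitems L) pi.
Proof.
  rewrite step_entropy.
  pose proof (MI_bsc_ge0 (Hmass L pi lq mq) (noise p L lq)
    (Hmass_bounds L lq mq pi (proj2 lq_bounds) mq_bound Hpi) noise_range); lra.
Qed.

Lemma step_entropy_search rl : (lstar L pi < L)%nat ->
  noise p L lq <= rl < 1/2 ->
  step_mean p L pi (entropy (Nitems L)) <= entropy (Nitems L) pi - MI_bsc (1/3) rl.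
Proof.
  intros Hs Hrl; rewrite step_entropy.
  destruct (hiePM_query_spec L pi HL Hpi) as [_ [_ [_ [Hmid _]]]].
  fold lq mq in Hmid.
  pose proof (MI_bsc_third_le_mid _ _ (Hmid Hs) noise_range).
  pose proof (MI_bsc_third_decr (noise p L lq) rl ltac:(lra) ltac:(lra)).
  lra.
Qed.

Lemma step_mean_sum {B} (F : B -> (nat -> R) -> R) s :
  step_mean p L pi (fun x => sumR (map (fun b => F b x) s)) =
  sumR (map (fun b => step_mean p L pi (F b)) s).
Proof.
  unfold step_mean; cbv zeta.
  now rewrite sumR_map_plus, !sumR_map_scal.
Qed.

(** Cell masses are martingales, so their squares are submartingales. *)
Lemma step_Hmass_sqr l m :
  Hmass L pi l m ^ 2 <= step_mean p L pi (fun x => Hmass L x l m ^ 2).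
Proof.
  eapply Rle_trans; [|apply (bayes_cell_sqr _ w pi r0 Hpi Hr0 w_ge w_sum)].
  apply Rminus_le_0; unfold Rminus at 1.
  match goal with |- 0 <= ?a + ?b + - ?c => replace (a + b + - c) with b end.
  - apply pow2_ge_0.
  - unfold Hmass, sum_range; ring.
Qed.

(** The lower bound [d] serves two regimes: [2/9] for masses in [[1/3, 2/3]], and [a / 2] for a leaf
    of mass in [[1/2, 1 - a]]. *)
Lemma step_Hmass_sqr_query d :
  0 <= d <= Hmass L pi lq mq * (1 - Hmass L pi lq mq) ->
  Hmass L pi lq mq ^ 2 + (d * (1 - 2 * r1)) ^ 2
  <= step_mean p L pi (fun x => Hmass L x lq mq ^ 2).
Proof.
  intros Hd; unfold step_mean; cbv zeta; fold w.
  change (update p L pi) with (bayes (Nitems L) w pi); rewrite wE.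
  eapply Rle_trans; [|apply query_Hmass_sqr; try assumption; apply lq_bounds].
  apply Rplus_le_compat_l, pow_incr.
  pose proof (Hnoise lq lq_bounds); split.
  - apply Rmult_le_pos; lra.
  - apply Rmult_le_compat; lra.
Qed.

Lemma step_level_sqr l : level_sqr L pi l <= step_mean p L pi (fun x => level_sqr L x l).
Proof.
  unfold level_sqr, sum_range.
  rewrite (step_mean_sum (fun m x => Hmass L x l m ^ 2)).
  apply sumR_map_le; intros; apply step_Hmass_sqr.
Qed.

Lemma step_level_sqr_query d :
  0 <= d <= Hmass L pi lq mq * (1 - Hmass L pi lq mq) ->
  level_sqr L pi lq + (d * (1 - 2 * r1)) ^ 2
  <= step_mean p L pi (fun x => level_sqr L x lq).
Proof.
  intros Hd; unfold level_sqr, sum_range.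
  rewrite (step_mean_sum (fun m x => Hmass L x lq m ^ 2)).
  apply sumR_map_le_gap with mq.
  - apply in_seq; lia.
  - intros; apply step_Hmass_sqr.
  - now apply step_Hmass_sqr_query.
Qed.

Lemma step_upper_sqr k : upper_sqr L pi k <= step_mean p L pi (fun x => upper_sqr L x k).
Proof.
  unfold upper_sqr, sum_range.
  rewrite (step_mean_sum (fun l x => level_sqr L x l)).
  apply sumR_map_le; intros; apply step_level_sqr.
Qed.

(** The queried level is at most one more than [lstar], hence at most [k], so its gain is one of the
    summands. *)
Lemma step_upper_sqr_query k : (lstar L pi < k <= L)%nat ->
  upper_sqr L pi k + (2/9 * (1 - 2 * r1)) ^ 2 <= step_mean p L pi (fun x => upper_sqr L x k).
Proof.
  intros Hk; destruct (hiePM_query_spec L pi HL Hpi) as [_ [_ [Hl [Hmid _]]]].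
  specialize (Hmid ltac:(lia)); fold lq mq in Hmid; fold lq in Hl.
  unfold upper_sqr, sum_range.
  rewrite (step_mean_sum (fun l x => level_sqr L x l)).
  apply sumR_map_le_gap with lq.
  - apply in_seq; lia.
  - intros; apply step_level_sqr.
  - apply step_level_sqr_query; nra.
Qed.

Let leaf_query : lstar L pi = L -> lq = L /\ 1/2 <= pi mq.
Proof.
  intros E; destruct (hiePM_query_spec L pi HL Hpi) as [H0 [_ [Hl [_ Hhalf]]]].
  fold lq in H0, Hl; fold lq mq in Hhalf; specialize (Hhalf E).
  assert (El : lq = L) by lia.
  rewrite El, Hmass_leaf in Hhalf; now split.
Qed.

Lemma step_log_compl_pot :
  log_compl_pot (Nitems L) pi <= step_mean p L pi (log_compl_pot (Nitems L)).
Proof.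
  unfold log_compl_pot, sum_range.
  rewrite (step_mean_sum (fun i x => - ln (1 - x i))).
  apply sumR_map_le; intros i Hi; apply in_seq in Hi.
  apply (bayes_log_compl _ w pi r0 Hpi Hr0 w_ge w_sum); [lia|].
  apply (posterior_lt_1 (Nitems L)); [apply Nitems_gt_1|exact Hpi|lia].
Qed.

Lemma step_leaf a : lstar L pi = L -> 0 < a < 1/2 ->
  level_sqr L pi L + (a / 2 * (1 - 2 * r1)) ^ 2
    <= step_mean p L pi (fun x => level_sqr L x L)
  \/ log_compl_pot (Nitems L) pi + C1cap r0 * (1 - 2 * a)
    <= step_mean p L pi (log_compl_pot (Nitems L)).
Proof.
  intros E Ha; destruct (leaf_query E) as [El Hhalf].
  assert (Hmq : (mq < Nitems L)%nat) by (unfold Nitems; rewrite <- El; exact mq_bound).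
  pose proof (posterior_lt_1 (Nitems L) pi mq Nitems_gt_1 Hpi Hmq) as H1.
  (* Up to [1 - a] the leaf mass still fluctuates enough for the second moment; beyond it,
     [2 * pi mq - 1] is at least [1 - 2 * a]. *)
  destruct (Rle_dec (pi mq) (1 - a)) as [Hx|Hx].
  - left; pose proof (step_level_sqr_query (a / 2)) as H.
    rewrite El, Hmass_leaf in H; apply H; nra.
  - right; unfold log_compl_pot, sum_range.
    rewrite (step_mean_sum (fun i x => - ln (1 - x i))).
    apply sumR_map_le_gap with mq.
    + apply in_seq; lia.
    + intros i Hi; apply in_seq in Hi.
      apply (bayes_log_compl _ w pi r0 Hpi Hr0 w_ge w_sum); [lia|].
      apply (posterior_lt_1 (Nitems L)); [apply Nitems_gt_1|exact Hpi|lia].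
    + pose proof (query_leaf_log_compl p L mq pi Hmq Hpi) as H; cbv zeta in H.
      pose proof (Hnoise L ltac:(lia)) as HnL; rewrite HnoiseL in H, HnL.
      rewrite <- (eq_trans wE (f_equal (fun l => chan p L (l, mq)) El)) in H.
      unfold step_mean; cbv zeta; fold w.
      change (update p L pi) with (bayes (Nitems L) w pi).
      eapply Rle_trans; [|apply H; lra].
      apply Rplus_le_compat_l, Rmult_le_compat_l; [|lra].
      apply KL_bern_ge0; lra.
Qed.

End Drift.

(** * Law of the observation paths and the Lyapunov bound on the stopping time *)

Lemma INR_Nitems L : INR (Nitems L) = 2 ^ L.
Proof. unfold Nitems; rewrite pow_INR; now replace (INR 2) with 2 by (simpl; ring). Qed.

Lemma prior_posterior L : is_posterior (Nitems L) (prior L).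
Proof.
  pose proof (pow_lt 2 L ltac:(lra)) as H; split.
  - intros i _; now apply Rinv_0_lt_compat.
  - unfold prior, sum_range; rewrite sumR_map_const, length_seq, INR_Nitems.
    unfold delta; field; lra.
Qed.

Definition path_prob (p : R -> R) (L : nat) (ys : list bool) : R :=
  sum_range 0 (Nitems L) (fun theta => delta L * lik p L theta ys).

Lemma path_prob_nil p L : path_prob p L nil = 1.
Proof.
  unfold path_prob; rewrite <- (proj2 (prior_posterior L)).
  apply sumR_map_ext; intros; unfold prior; simpl; ring.
Qed.

Lemma sumR_allseqs_S F t :
  sumR (map F (allseqs (S t))) =
  sumR (map (fun ys => F (true :: ys) + F (false :: ys)) (allseqs t)).
Proof.
  simpl; induction (allseqs t) as [|a s IH]; simpl; [easy|rewrite IH; ring].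
Qed.

Section Paths.
Context (p : R -> R) (L : nat) (eps r0 r1 : R).
Hypotheses (HL : (0 < L)%nat) (Hr0 : 0 < r0) (Hr1 : r1 < 1/2).
Hypothesis Hnoise : forall l, (0 < l <= L)%nat -> r0 <= noise p L l <= r1.

Lemma post_posterior ys : is_posterior (Nitems L) (post p L ys).
Proof.
  induction ys as [|y ys IH]; [apply prior_posterior|].
  now apply (update_posterior p L r0 r1).
Qed.

(** The recursive update is the true conditional law: the joint weight of target and path factors
    through the posterior. Hence each new answer multiplies the path probability by its evidence. *)
Lemma path_prob_spec ys :
  (forall theta, (theta < Nitems L)%nat ->
     delta L * lik p L theta ys = path_prob p L ys * post p L ys theta) /\
  0 <= path_prob p L ys /\
  forall y, path_prob p L (y :: ys) = path_prob p L ys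
    * evidence (Nitems L) (chan p L (hiePM_query L (post p L ys))) (post p L ys) y.
Proof.
  assert (Hcons : forall ys,
    (forall theta, (theta < Nitems L)%nat ->
       delta L * lik p L theta ys = path_prob p L ys * post p L ys theta) ->
    forall y, path_prob p L (y :: ys) = path_prob p L ys
      * evidence (Nitems L) (chan p L (hiePM_query L (post p L ys))) (post p L ys) y).
  { clear ys; intros ys H y; unfold path_prob at 1, evidence, sum_range.
    rewrite <- sumR_map_scal; apply sumR_map_ext; intros i Hi; apply in_seq in Hi.
    cbn [lik]; rewrite <- Rmult_assoc, H by lia; ring. }
  assert (Hev : forall ys y,
    0 < evidence (Nitems L) (chan p L (hiePM_query L (post p L ys))) (post p L ys) y).
  { clear ys; intros ys y; pose proof (post_posterior ys) as Hpi.
    destruct (hiePM_query_spec L _ HL Hpi) as [Hl [Hm _]].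
    revert Hl Hm; destruct (hiePM_query L (post p L ys)) as [l m]; cbn [fst snd].
    intros Hl Hm; pose proof (Hnoise l Hl).
    apply evidence_pos with (r := noise p L l); [exact Hpi|lra|].
    apply chan_ge; lra. }
  induction ys as [|y ys [IH1 [IH2 IH3]]].
  - pose proof (path_prob_nil p L) as H1.
    assert (H : forall theta, (theta < Nitems L)%nat ->
     delta L * lik p L theta nil = path_prob p L nil * post p L nil theta)
      by (intros; rewrite H1; simpl; unfold prior; ring).
    split; [exact H|split; [lra|now apply Hcons]].
  - assert (H : forall theta, (theta < Nitems L)%nat ->
     delta L * lik p L theta (y :: ys) = path_prob p L (y :: ys) * post p L (y :: ys) theta).
    { intros theta Ht; rewrite IH3; cbn [lik post].
      rewrite <- Rmult_assoc, IH1 by exact Ht.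
      pose proof (Hev ys y) as HZ; unfold update.
      fold (evidence (Nitems L) (chan p L (hiePM_query L (post p L ys))) (post p L ys) y).
      field; lra. }
    split; [exact H|split; [|now apply Hcons]].
    rewrite IH3; apply Rmult_le_pos; [exact IH2|left; apply Hev].
Qed.

(** The event [tau >= length ys]: the last posterior may already be the stopping one. *)
Definition running_before (ys : list bool) : bool :=
  match ys with nil => true | _ :: r => running p L eps r end.

Lemma runningE ys : running p L eps ys =
  ((if Rle_dec (maxpost L (post p L ys)) (1 - eps) then true else false)
   && running_before ys)%bool.
Proof. now destruct ys. Qed.

(** Foster's argument: each step taken before stopping costs one unit of the mean of [A], and what
    remains at time [T] is nonnegative, so the truncated expectations never exceed the initial
    value. *)
Lemma expected_tau_le_lyapunov (A : (nat -> R) -> R) :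
  0 <= A (prior L) ->
  (forall pi, is_posterior (Nitems L) pi -> maxpost L pi <= 1 - eps ->
     (forall y, 0 <= A (update p L pi y)) /\ step_mean p L pi A <= A pi - 1) ->
  Rbar_le (expected_tau p L eps) (A (prior L)).
Proof.
  intros HA0 HA.
  set (F := fun ys => if running_before ys then path_prob p L ys * A (post p L ys) else 0).
  assert (HF0 : forall ys, 0 <= F ys).
  { intros ys; unfold F; destruct (running_before ys) eqn:E; [|lra].
    apply Rmult_le_pos; [apply path_prob_spec|].
    destruct ys as [|y ys]; [exact HA0|].
    cbn [running_before] in E; rewrite runningE in E.
    destruct (Rle_dec (maxpost L (post p L ys)) (1 - eps)) as [Hm|]; [|easy].
    now apply HA; [apply post_posterior|]. }
  (* Path by path, the value at [ys] pays for one more time step and for both extensions; after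
     stopping the extensions have value 0. *)
  assert (HF : forall ys,
    (if running p L eps ys then path_prob p L ys else 0)
    + (F (true :: ys) + F (false :: ys)) <= F ys).
  { intros ys; destruct (running p L eps ys) eqn:E.
    - unfold F; cbn [running_before]; rewrite E.
      rewrite runningE in E.
      destruct (Rle_dec (maxpost L (post p L ys)) (1 - eps)) as [Hm|]; [|easy].
      simpl in E; rewrite E.
      destruct (HA _ (post_posterior ys) Hm) as [_ H].
      destruct (path_prob_spec ys) as [_ [HP Hc]]; rewrite !Hc.
      unfold step_mean in H; cbv zeta in H; cbn [post].
      apply Rmult_le_compat_l with (r := path_prob p L ys) in H; [|exact HP]; lra.
    - unfold F at 1 2; cbn [running_before]; rewrite E; pose proof (HF0 ys); lra. }
  assert (HT : forall T, sum_range 0 T (prob_tau_gt p L eps) + sumR (map F (allseqs T))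
                         <= A (prior L)).
  { induction T as [|T IH].
    - unfold sum_range, F; simpl.
      rewrite path_prob_nil; lra.
    - rewrite sum_range_S, sumR_allseqs_S.
      pose proof (sumR_map_le _ _ (allseqs T) (fun ys _ => HF ys)) as H.
      rewrite sumR_map_plus in H.
      change (sumR (map (fun ys => if running p L eps ys then path_prob p L ys else 0)
        (allseqs T))) with (prob_tau_gt p L eps T) in H; lra. }
  apply (is_sup_seq_lub _ _ (Sup_seq_correct _)).
  intros x [T ->]; simpl.
  pose proof (HT T); pose proof (sumR_map_nonneg F (allseqs T) (fun ys _ => HF0 ys)); lra.
Qed.

End Paths.

(** * Estimates uniform in the noise level *)

Lemma C1cap_decr r r' : 0 < r <= r' -> r' < 1/2 -> C1cap r' <= C1cap r.
Proof.
  intros Hr Hr'; rewrite !C1capE, !ln_div by lra.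
  pose proof (ln_le r r' ltac:(lra) ltac:(lra)).
  pose proof (ln_le (1 - r') (1 - r) ltac:(lra) ltac:(lra)).
  pose proof (ln_le r' (1 - r') ltac:(lra) ltac:(lra)).
  apply Rmult_le_compat; lra.
Qed.

Lemma C1cap_gt0 r : 0 < r < 1/2 -> 0 < C1cap r.
Proof. intros Hr; apply KL_bern_gt0; lra. Qed.

(** Both the overshoot and [C1cap r] grow like [ln (1 / r)], so their ratio stays bounded however
    small the noise. The additive 2 is absorbed because [ln ((1 - r) / r)] is at least its value at
    [r']. *)
Lemma ln_inv_le_C1cap r r' : 0 < r <= r' -> r' < 1/2 ->
  ln (1 / r) + 1 <= (1 + 2 / ln ((1 - r') / r')) / (1 - 2 * r') * C1cap r.
Proof.
  intros Hr Hr'; rewrite C1capE by lra.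
  assert (Hx : ln ((1 - r') / r') <= ln ((1 - r) / r)).
  { rewrite !ln_div by lra.
    pose proof (ln_le r r' ltac:(lra) ltac:(lra)).
    pose proof (ln_le (1 - r') (1 - r) ltac:(lra) ltac:(lra)); lra. }
  assert (Hx0 : 0 < ln ((1 - r') / r')).
  { rewrite ln_div by lra.
    pose proof (ln_increasing r' (1 - r') ltac:(lra) ltac:(lra)); lra. }
  (* The additional 1 bounds [- ln (1 - r)], which is at most [1 / (1 - r) - 1]. *)
  assert (H : ln (1 / r) + 1 <= ln ((1 - r) / r) + 2).
  { rewrite !ln_div, ln_1 by lra.
    pose proof (ln_le_sub1 (/ (1 - r)) ltac:(apply Rinv_0_lt_compat; lra)) as G.
    rewrite ln_Rinv in G by lra.
    assert (/ (1 - r) <= 2).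
    { replace 2 with (/ (1/2)) by field; apply Rinv_le_contravar; lra. }
    lra. }
  set (x := ln ((1 - r) / r)) in *; set (x' := ln ((1 - r') / r')) in *.
  apply (Rle_trans _ _ _ H).
  replace (_ * ((1 - 2 * r) * x))
    with ((1 - 2 * r) / (1 - 2 * r') * (x + 2 * (x / x'))) by (field; lra).
  assert (H1 : 1 <= (1 - 2 * r) / (1 - 2 * r')).
  { apply (Rle_div_r 1 (1 - 2 * r)); lra. }
  assert (H2 : 1 <= x / x') by (apply (Rle_div_r 1 x); lra).
  replace (x + 2) with (1 * (x + 2)) by ring.
  apply Rmult_le_compat; lra.
Qed.

Lemma noiseE p L l : (l <= L)%nat -> noise p L l = p (/ 2 ^ l).
Proof.
  intros Hl; unfold noise, Hsize, delta; f_equal.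
  rewrite pow_INR; replace (INR 2) with 2 by (simpl; ring).
  pose proof (pow_lt 2 l ltac:(lra)); pose proof (pow_lt 2 (L - l) ltac:(lra)).
  replace L with (l + (L - l))%nat at 2 by lia; rewrite pow_add; field; lra.
Qed.

Lemma inv_pow2_bounds l L : (0 < l <= L)%nat -> 0 < / 2 ^ L <= / 2 ^ l /\ / 2 ^ l <= 1/2.
Proof.
  intros Hl; pose proof (pow_lt 2 l ltac:(lra)); pose proof (pow_lt 2 L ltac:(lra)).
  split; [split; [now apply Rinv_0_lt_compat|]|].
  - apply Rinv_le_contravar; [assumption|apply Rle_pow; [lra|lia]].
  - replace (1/2) with (/ 2 ^ 1) by (simpl; field).
    apply Rinv_le_contravar; [simpl; lra|apply Rle_pow; [lra|lia]].
Qed.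

(** * The combined Lyapunov function and an explicit bound *)

Lemma step_mean_affine p L pi c1 c2 c3 c4 b2 b3 b4 f1 f2 f3 f4 :
  is_posterior (Nitems L) pi ->
  step_mean p L pi (fun x => c1 * f1 x + c2 * (b2 - f2 x) + c3 * (b3 - f3 x)
                             + c4 * (b4 - f4 x)) =
  c1 * step_mean p L pi f1 + c2 * (b2 - step_mean p L pi f2)
  + c3 * (b3 - step_mean p L pi f3) + c4 * (b4 - step_mean p L pi f4).
Proof.
  intros Hpi; unfold step_mean; cbv zeta.
  pose proof (evidence_sum (Nitems L) (chan p L (hiePM_query L pi)) pi Hpi
    (chan_sum p L (hiePM_query L pi))) as E.
  set (zt := evidence _ _ _ true) in *; set (zf := evidence _ _ _ false) in *.
  replace zf with (1 - zt) by lra; ring.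
Qed.

Lemma entropy_prior L : entropy (Nitems L) (prior L) = ln (1 / delta L).
Proof.
  unfold entropy, prior, sum_range; rewrite sumR_map_const, length_seq, INR_Nitems.
  pose proof (pow_lt 2 L ltac:(lra)).
  rewrite ln_div, ln_1; [|lra|unfold delta; now apply Rinv_0_lt_compat].
  replace (- (delta L * ln (delta L))) with (delta L * - ln (delta L)) by ring.
  rewrite <- Rmult_assoc; replace (2 ^ L * delta L) with 1 by (unfold delta; field; lra).
  ring.
Qed.

(* Lyapunov function of the posterior: every term is a nonnegative supermartingale before
   stopping, and at each step one of them decreases by at least [1] on average. *)
Definition lyapunov (L k : nat) (cH cP cU cV bP bU : R) (x : nat -> R) : R :=
  cH * entropy (Nitems L) x + cP * (bP - log_compl_pot (Nitems L) x)
  + cU * (bU - upper_sqr L x k) + cV * (1 - level_sqr L x L).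

(** Each coefficient is the reciprocal of the drift guaranteed in its regime: the active term pays 1
    and the others do not increase in mean. The right side dominates the value at the prior. *)
Lemma expected_tau_le (p : R -> R) (L k : nat) (eps r0 rl r1 a : R) :
  (0 < L)%nat -> 0 < eps < 1 -> 0 < a < 1/2 -> 0 < r0 -> r1 < 1/2 -> 0 < rl < 1/2 ->
  (forall l, (0 < l <= L)%nat -> r0 <= noise p L l <= r1) -> noise p L L = r0 ->
  (forall l, (k <= l <= L)%nat -> noise p L l <= rl) ->
  Rbar_le (expected_tau p L eps)
    (ln (1 / delta L) / MI_bsc (1/3) rl
     + (ln (1 / eps) + ln (1 / r0) + 1) / (C1cap r0 * (1 - 2 * a))
     + INR (S k) * 2 ^ k / (2/9 * (1 - 2 * r1)) ^ 2
     + 1 / (a / 2 * (1 - 2 * r1)) ^ 2).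
Proof.
  intros HL He Ha Hr0 Hr1 Hrl Hn HnL Hnk.
  set (bP := ln (1 / eps) + ln (1 / r0) + 1).
  set (bU := INR (S k) * 2 ^ k).
  set (vU := (2/9 * (1 - 2 * r1)) ^ 2); set (vV := (a / 2 * (1 - 2 * r1)) ^ 2).
  assert (Hr01 : r0 <= r1) by (pose proof (Hn L ltac:(lia)); lra).
  assert (HvU : 0 < vU) by (apply pow_lt; lra).
  assert (HvV : 0 < vV) by (apply pow_lt, Rmult_lt_0_compat; lra).
  assert (HI : 0 < MI_bsc (1/3) rl) by (apply MI_bsc_third_gt0; lra).
  assert (HC : 0 < C1cap r0 * (1 - 2 * a))
    by (apply Rmult_lt_0_compat; [apply C1cap_gt0|]; lra).
  set (cH := / MI_bsc (1/3) rl); set (cP := / (C1cap r0 * (1 - 2 * a))).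
  assert (HcH : 0 < cH) by now apply Rinv_0_lt_compat.
  assert (HcP : 0 < cP) by now apply Rinv_0_lt_compat.
  assert (HcU : 0 < / vU) by now apply Rinv_0_lt_compat.
  assert (HcV : 0 < / vV) by now apply Rinv_0_lt_compat.
  (* Truncation keeps all cell levels within the tree when [k] exceeds [L]. *)
  set (k0 := Nat.min k L).
  set (A := lyapunov L k0 cH cP (/ vU) (/ vV) bP bU).
  assert (HA0 : forall x, is_posterior (Nitems L) x ->
            log_compl_pot (Nitems L) x <= bP -> 0 <= A x).
  { intros x Hx HP; unfold A, lyapunov.
    pose proof (entropy_ge0 _ x Hx).
    pose proof (upper_sqr_le L x k0 k ltac:(lia) ltac:(lia) Hx) as HU; fold bU in HU.
    pose proof (level_sqr_leaf_le_1 L x Hx).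
    repeat apply Rplus_le_le_0_compat; apply Rmult_le_pos; lra. }
  pose proof (prior_posterior L) as Hprior.
  assert (Hd : 0 < delta L <= 1/2) by (unfold delta; destruct (inv_pow2_bounds L L); lra || lia).
  assert (HAprior : 0 <= A (prior L)).
  { apply HA0; [exact Hprior|].
    (* The prior may already meet the stopping condition, so the bound is checked directly:
       [eps * r0 <= 1/2 <= 1 - delta L]. *)
    apply log_compl_pot_le; [exact Hprior|]; intros i _; unfold prior; split; [lra|].
    pose proof (ln_le (eps * r0) (1 - delta L) ltac:(nra) ltac:(nra)) as G.
    rewrite ln_mult in G by lra; rewrite !ln_div, ln_1 by lra; lra. }
  eapply Rbar_le_trans.
  - apply (expected_tau_le_lyapunov p L eps r0 r1 HL Hr0 Hr1 Hn A HAprior).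
    intros pi Hpi Hmax.
    assert (Hrun : forall i, (i < Nitems L)%nat -> pi i <= 1 - eps).
    { intros i Hi; eapply Rle_trans; [|exact Hmax]; apply le_fold_Rmax, in_seq; lia. }
    split.
    + intros y; apply HA0.
      * now apply (update_posterior p L r0 r1).
      * now apply (update_log_compl_pot p L r0 r1).
    + unfold A at 1, lyapunov; rewrite step_mean_affine by exact Hpi.
      pose proof (step_entropy_le p L r0 r1 pi HL Hr0 Hr1 Hn Hpi) as GH.
      pose proof (step_log_compl_pot p L r0 r1 pi HL Hr0 Hr1 Hn Hpi) as GP.
      pose proof (step_upper_sqr p L r0 r1 pi HL Hr0 Hr1 Hn Hpi k0) as GU.
      pose proof (step_level_sqr p L r0 r1 pi HL Hr0 Hr1 Hn Hpi L) as GV.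
      pose proof (Rmult_le_compat_l cH _ _ (Rlt_le _ _ HcH) GH) as GH'.
      pose proof (Rmult_le_compat_l cP _ _ (Rlt_le _ _ HcP) GP) as GP'.
      pose proof (Rmult_le_compat_l (/ vU) _ _ (Rlt_le _ _ HcU) GU) as GU'.
      pose proof (Rmult_le_compat_l (/ vV) _ _ (Rlt_le _ _ HcV) GV) as GV'.
      unfold A, lyapunov.
      destruct (lstar_bounds L pi HL Hpi) as [_ HlL].
      (* Three regimes: a leaf is selected, the selected level lies from [k0] up to below [L], or it
         lies above [k0] in the tree. *)
      destruct (Nat.le_gt_cases k0 (lstar L pi)) as [Hk|Hk];
        [destruct (Nat.eq_dec (lstar L pi) L) as [El|El]|].
      * destruct (step_leaf p L r0 r1 pi HL Hr0 Hr1 Hn HnL Hpi a El Ha) as [G|G].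
        -- fold vV in G; apply Rmult_le_compat_l with (r := / vV) in G; [|lra].
           rewrite Rmult_plus_distr_l, Rinv_l in G by lra; lra.
        -- apply Rmult_le_compat_l with (r := cP) in G; [|lra].
           rewrite Rmult_plus_distr_l in G; unfold cP at 2 in G.
           rewrite Rinv_l in G by lra; lra.
      * pose proof (hiePM_query_spec L pi HL Hpi) as [Hq [_ [Hls _]]].
        set (lq := fst (hiePM_query L pi)) in *.
        (* Here [k0 <= lstar L pi < L] forces [k0 = k], and the queried level is at least [k]. *)
        assert (Hnq : noise p L lq <= rl < 1/2) by (split; [apply Hnk; lia|lra]).
        pose proof (step_entropy_search p L r0 r1 pi HL Hr0 Hr1 Hn Hpi rl ltac:(lia) Hnq) as G.
        apply Rmult_le_compat_l with (r := cH) in G; [|lra].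
        unfold Rminus in G; rewrite Rmult_plus_distr_l in G; unfold cH at 3 in G.
        rewrite <- Ropp_mult_distr_r, Rinv_l in G by lra; lra.
      * pose proof (step_upper_sqr_query p L r0 r1 pi HL Hr0 Hr1 Hn Hpi k0 ltac:(lia)) as G.
        fold vU in G; apply Rmult_le_compat_l with (r := / vU) in G; [|lra].
        rewrite Rmult_plus_distr_l, Rinv_l in G by lra; lra.
  - simpl; unfold A, lyapunov; rewrite entropy_prior.
    assert (HP : 0 <= log_compl_pot (Nitems L) (prior L)).
    { apply sumR_map_nonneg; intros i _; unfold prior.
      pose proof (ln_le (1 - delta L) 1 ltac:(lra) ltac:(lra)) as G; rewrite ln_1 in G; lra. }
    assert (HV : forall l, 0 <= level_sqr L (prior L) l)
      by (intros l; apply sumR_map_nonneg; intros; apply pow2_ge_0).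
    assert (HU : 0 <= upper_sqr L (prior L) k0)
      by (apply sumR_map_nonneg; intros; apply HV).
    pose proof (HV L) as HVL.
    fold bP bU vU vV.
    replace (ln (1 / delta L) / MI_bsc (1/3) rl) with (cH * ln (1 / delta L))
      by apply Rmult_comm.
    replace (bP / (C1cap r0 * (1 - 2 * a))) with (cP * bP) by apply Rmult_comm.
    replace (bU / vU) with (/ vU * bU) by apply Rmult_comm.
    replace (1 / vV) with (/ vV * 1) by apply Rmult_comm.
    pose proof (Rmult_le_pos _ _ (Rlt_le _ _ HcP) HP).
    pose proof (Rmult_le_pos _ _ (Rlt_le _ _ HcU) HU).
    pose proof (Rmult_le_pos _ _ (Rlt_le _ _ HcV) HVL).
    lra.
Qed.

(** * Choice of constants making the error uniform in [delta] and [eps] *)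

Theorem theorem2 (p : R -> R)
  (Hp_range : forall x, 0 < x < 1 -> 0 < p x < 1/2)
  (Hp_cont : forall x, 0 < x < 1 -> continuity_pt p x)
  (Hp_mono : forall x y, 0 < x -> x <= y -> y < 1 -> p x <= p y) :
  0 < Kh p /\
  forall l : R, 0 < l ->
  forall eta : R, 0 < eta ->
  exists M : R,
    forall (L : nat) (eps : R),
      0 < delta L < 1 ->
      0 < eps < 1 ->
      M <= ln (1 / (delta L * eps)) ->
      Rpower (exp 1 * ln (1 / (delta L * eps))) (- Kh p) < Rpower 2 (- l) ->
      Rbar_le (expected_tau p L eps)
        (Finite (ln (1 / delta L) / MI_bsc (1/3) (p (Rpower 2 (- l)))
                 + ln (1 / eps) / C1cap (p (delta L))
                 + eta * ln (1 / (delta L * eps)))).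
Proof.
  assert (Hr1 : 0 < p (1/2) < 1/2) by (apply Hp_range; lra).
  split.
  { apply Rmin_glb_lt; [now apply MI_bsc_third_gt0|].
    apply Rmult_lt_0_compat; [lra|apply KL_bern_gt0; lra]. }
  intros l Hl eta Heta.
  set (r1 := p (1/2)) in *.
  assert (Hx : 0 < Rpower 2 (- l) < 1).
  { split; [apply exp_pos|rewrite <- (Rpower_O 2) by lra; apply Rpower_lt; lra]. }
  pose proof (Hp_range _ Hx) as Hrl; set (rl := p (Rpower 2 (- l))) in *.
  (* The real exponent [l] is replaced by a natural level [k] above it: from level [k] on, cells
     have relative size at most [2^-l], hence noise at most [rl]. *)
  destruct (INR_unbounded l) as [k Hk].
  pose proof (C1cap_gt0 r1 Hr1) as HC1.
  (* Since [C1cap r1 <= C1cap r0], this makes [s / C1cap r0] at most [eta / 2]; [a] is then chosen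
     so that [1 / (1 - 2 * a)] equals [1 + s]. *)
  set (s := eta * C1cap r1 / 2).
  assert (Hs : 0 < s) by (unfold s; apply Rdiv_lt_0_compat; [nra|lra]).
  set (a := s / (2 * (1 + s))).
  assert (Ha0 : 0 < a) by (apply Rdiv_lt_0_compat; lra).
  assert (Ha : 1 - 2 * a = / (1 + s)) by (unfold a; field; lra).
  assert (Has : 0 < / (1 + s)) by (apply Rinv_0_lt_compat; lra).
  set (kappa := (1 + 2 / ln ((1 - r1) / r1)) / (1 - 2 * r1)).
  set (c := (1 + s) * kappa + INR (S k) * 2 ^ k / (2/9 * (1 - 2 * r1)) ^ 2
            + 1 / (a / 2 * (1 - 2 * r1)) ^ 2).
  (* The constant [c] collects every term free of [L] and [eps]; this threshold makes it at most
     half of the error allowance. *)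
  exists (2 * c / eta); intros L eps Hd He HM _.
  assert (HL : (0 < L)%nat).
  { destruct L; [|lia]; unfold delta in Hd; simpl in Hd; lra. }
  assert (Hpow : forall j, (0 < j <= L)%nat -> p (delta L) <= p (/ 2 ^ j) <= r1).
  { intros j Hj; pose proof (inv_pow2_bounds j L Hj).
    split; apply Hp_mono; unfold delta; lra. }
  pose proof (Hp_range _ Hd) as Hr0; set (r0 := p (delta L)) in *.
  pose proof (Hpow L ltac:(lia)) as [_ Hr01]; change (r0 <= r1) in Hr01.
  eapply Rbar_le_trans.
  - apply (expected_tau_le p L k eps r0 rl r1 a); try lra; try assumption.
    + intros j Hj; rewrite noiseE by lia; now apply Hpow.
    + rewrite noiseE by lia; reflexivity.
    + intros j Hj; rewrite noiseE by lia; apply Hp_mono; [| |lra].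
      * apply Rinv_0_lt_compat, pow_lt; lra.
      * rewrite <- Rpower_pow, <- Rpower_Ropp by lra.
        apply Rle_Rpower; [lra|]; pose proof (le_INR k j ltac:(lia)); lra.
  - pose proof (C1cap_decr r0 r1 ltac:(lra) ltac:(lra)) as HC01.
    pose proof (ln_inv_le_C1cap r0 r1 ltac:(lra) ltac:(lra)) as Hk0; fold kappa in Hk0.
    assert (HC0 : 0 < C1cap r0) by lra.
    assert (HE : 0 < ln (1 / eps)).
    { rewrite ln_div, ln_1 by lra.
      pose proof (ln_increasing eps 1 ltac:(lra) ltac:(lra)) as G; rewrite ln_1 in G; lra. }
    assert (HD : ln (1 / (delta L * eps)) = ln (1 / delta L) + ln (1 / eps)).
    { rewrite !ln_div, ln_1, ln_mult by (try lra; apply Rmult_lt_0_compat; lra); ring. }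
    assert (HD0 : 0 < ln (1 / delta L)).
    { rewrite ln_div, ln_1 by lra.
      pose proof (ln_increasing (delta L) 1 ltac:(lra) ltac:(lra)) as G.
      rewrite ln_1 in G; lra. }
    rewrite HD in HM |- *; cbn [Rbar_le].
    apply Rle_div_l in HM; [|lra].
    (* The reliability term splits into its leading part, a loss of at most [eta / 2 * ln (1 / eps)]
       caused by [a], and a bounded overshoot. *)
    assert (HP : (ln (1 / eps) + ln (1 / r0) + 1) / (C1cap r0 * (1 - 2 * a))
                 <= ln (1 / eps) / C1cap r0 + eta / 2 * ln (1 / eps) + (1 + s) * kappa).
    { rewrite Ha.
      replace (_ / (C1cap r0 * / (1 + s)))
        with (ln (1 / eps) / C1cap r0 + s / C1cap r0 * ln (1 / eps)
              + (1 + s) * ((ln (1 / r0) + 1) / C1cap r0)) by (field; lra).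
      apply Rplus_le_compat; [apply Rplus_le_compat_l, Rmult_le_compat_r; [lra|]|
        apply Rmult_le_compat_l; [lra|]].
      - apply Rle_div_l; [lra|]; unfold s; nra.
      - apply Rle_div_l; lra. }
    pose proof (Rmult_lt_0_compat _ _ Heta HD0); unfold c in HM; lra.
Qed.
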